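(* Let $(P,\omega)$ be a symplectic manifold of dimension $2m$ that has a Poisson connection $D$ whose torsion is vanishing. Let $\{e_1,\dots,e_{2m}\}$ be a local frame field on some local chart $U$ in $P$ and $\{\theta^1,\dots,\theta^{2m}\}$ its dual coframe field. Then the curvature 2-section $R_D$ of $D$ satisfies on $U$ the equation \[ (-1)^a\sum_{1\le i<j\le 2m}\omega(e_i,e_j)\,R_D(\theta^i,\theta^j)A=\sum_{i,j=1}^{2m}e_i\wedge i(\flat(e_j))\,R_D(\theta^i,\theta^j)A \] for any $a$-vector field $A\in\mathfrak{X}^a(P)$.
   Context: $\mathfrak{X}^k(P)=\Gamma^\infty(\wedge^kTP)$ and $\Omega^k(P)=\Gamma^\infty(\wedge^kT^*P)$; the pairing is $\langle\alpha_1\wedge\cdots\wedge\alpha_k,X_1\wedge\cdots\wedge X_k\rangle=\det(\alpha_i(X_j))$. Symplectic conventions: $\flat:\mathfrak{X}^1(P)\to\Omega^1(P)$, $\flat(X)=\omega(X,\cdot)$, is invertible with inverse $\sharp$; the Poisson bivector $\Pi$ of $\omega$ is defined by $\langle\beta\wedge\alpha,\Pi\rangle=\beta(\sharp\alpha)$ for 1-forms $\alpha,\beta$. Interior product by a form: for $A\in\mathfrak{X}^a(P)$, $\eta\in\Omega^p(P)$, $a\ge p$, $i(\eta)A\in\mathfrak{X}^{a-p}(P)$ is defined by $\langle\tau,i(\eta)A\rangle=\langle\tau\wedge\eta,A\rangle$ for all $(a-p)$-forms $\tau$; $i(\eta)A=0$ if $a<p$. A contravariant derivative $D$ assigns to 1-forms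 $\eta,\alpha$ a 1-form $D_\eta\alpha$, $\mathbb{R}$-linearly in $\alpha$, $C^\infty(P)$-linearly in $\eta$, with $D_\eta(f\alpha)=fD_\eta\alpha+((\sharp\eta)f)\alpha$. It extends to multivector fields by $\langle\alpha_1\wedge\cdots\wedge\alpha_a,D_\eta A\rangle=(\sharp\eta)\langle\alpha_1\wedge\cdots\wedge\alpha_a,A\rangle-\sum_{i=1}^a\langle\alpha_1\wedge\cdots\wedge D_\eta\alpha_i\wedge\cdots\wedge\alpha_a,A\rangle$ for $A\in\mathfrak{X}^a(P)$ (and $D_\eta f=(\sharp\eta)f$ on functions). $D$ is a Poisson connection if $D\Pi=0$. With $[\alpha,\beta]_\Pi=\mathcal{L}_{\sharp\alpha}\beta-\mathcal{L}_{\sharp\beta}\alpha+d\langle\alpha\wedge\beta,\Pi\rangle$, the torsion of $D$ is $T_D(\alpha,\beta)=D_\alpha\beta-D_\beta\alpha-[\alpha,\beta]_\Pi$ (vanishing means $T_D(\alpha,\beta)=0$ for all 1-forms), and the curvature 2-section is $R_D(\alpha,\beta)=D_\alpha D_\beta-D_\beta D_\alpha-D_{[\alpha,\beta]_\Pi}$, acting here on multivector fields via the extended $D$. *)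

(* Defs.v *)
From HB Require Import structures.
From mathcomp Require Import all_boot all_order all_algebra.
From mathcomp Require Import all_classical all_reals all_analysis.
Import Order.TTheory GRing.Theory Num.Theory.
Import numFieldNormedType.Exports.

Set Implicit Arguments.
Unset Strict Implicit.
Unset Printing Implicit Defensive.

Local Open Scope classical_set_scope.
Local Open Scope ring_scope.

Fixpoint iter_derive (R : realType) (n : nat) (s : seq 'rV[R]_n)
    (f : 'rV[R]_n -> R) : 'rV[R]_n -> R :=
  if s is v :: s' then 'D_v (iter_derive s' f) else f.

(* C^infty on the open set O: every iterated directional derivative is
   Frechet differentiable (hence continuous) at every point of O. *)
Definition smooth_euclid (R : realType) (n : nat) (O : set 'rV[R]_n)
    (f : 'rV[R]_n -> R) : Prop :=
  forall s x, O x -> differentiable (iter_derive s f) x.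

Definition smooth_euclid_map (R : realType) (n : nat) (O : set 'rV[R]_n)
    (F : 'rV[R]_n -> 'rV[R]_n) : Prop :=
  forall i : 'I_n, smooth_euclid O (fun x => F x ord0 i).

(* [coord] is only meaningful on [dom], and [param] on [coord @` dom]. *)
Record chart (R : realType) (n : nat) (T : Type) := Chart {
  dom : set T ;
  coord : T -> 'rV[R]_n ;
  param : 'rV[R]_n -> T }.

Definition is_chart (R : realType) (n : nat) (T : topologicalType)
    (c : chart R n T) : Prop :=
  [/\ open (dom c), open (coord c @` dom c),
      forall p, dom c p -> param c (coord c p) = p,
      forall p, dom c p -> {for p, continuous (coord c)} &
      forall x, (coord c @` dom c) x -> {for x, continuous (param c)}].

Definition compatible (R : realType) (n : nat) (T : Type)
    (c c' : chart R n T) : Prop :=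
  smooth_euclid_map (coord c @` (dom c `&` dom c')) (coord c' \o param c).

Record manifold (R : realType) (n : nat) := Manifold {
  carrier :> topologicalType ;
  atlas : set (chart R n carrier) ;
  _ : hausdorff_space carrier ;
  _ : @second_countable carrier ;
  _ : forall c, atlas c -> is_chart c ;
  _ : forall p, exists2 c, atlas c & dom c p ;
  _ : forall c c', atlas c -> atlas c' -> compatible c c' }.

(* The charts of the maximal atlas. *)
Definition smooth_chart (R : realType) (n : nat) (M : manifold R n)
    (c : chart R n M) : Prop :=
  is_chart c /\
  forall c', atlas c' -> compatible c c' /\ compatible c' c.

(* Functions on an open subset V, and below all fields on V, are represented by
   total functions on M whose values outside V are irrelevant. *)
Definition smooth_on (R : realType) (n : nat) (M : manifold R n) (V : set M)
    (f : M -> R) : Prop :=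
  forall c, atlas c ->
    smooth_euclid (coord c @` (dom c `&` V)) (f \o param c).

Definition smooth_near (R : realType) (n : nat) (M : manifold R n) (p : M)
    (f : M -> R) : Prop :=
  exists V : set M, [/\ open V, V p & smooth_on V f].

(* Tangent vectors at p are the derivations of the algebra of germs at p of
   smooth functions.  A derivation is applied to arbitrary functions M -> R; the
   first clause fixes the irrelevant values, so that equality of tangent vectors
   is equality of derivations. *)
Definition is_derivation (R : realType) (n : nat) (M : manifold R n) (p : M)
    (v : (M -> R) -> R^o) : Prop :=
  [/\ forall f, ~ smooth_near p f -> v f = 0,
      forall f g, smooth_near p f -> smooth_near p g ->
        (\forall q \near p, f q = g q) -> v f = v g,
      forall a f g, smooth_near p f -> smooth_near p g ->
        v (fun q => a * f q + g q) = a * v f + v g &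
      forall f g, smooth_near p f -> smooth_near p g ->
        v (fun q => f q * g q) = f p * v g + g p * v f].

Definition derivation (R : realType) (n : nat) (M : manifold R n) (p : M) :
  {pred (M -> R) -> R^o} := fun v => `[< is_derivation p v >].

Lemma derivation_submod_closed (R : realType) (n : nat) (M : manifold R n)
  (p : M) : submod_closed (derivation p).
Proof.
split; first by apply/asboolP; split=> *; rewrite /= ?mulr0 ?addr0.
move=> k v w /asboolP[v0 vl vD vM] /asboolP[w0 wl wD wM]; apply/asboolP.
have E f : (k *: v + w) f = k * v f + w f by [].
split=> [f nf|f g sf sg fg|a f g sf sg|f g sf sg]; rewrite !E.
- by rewrite v0// w0// mulr0 addr0.
- by rewrite (vl f g)// (wl f g).
- by rewrite vD// wD// !mulrDr !mulrA (mulrC k a) addrACA.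
- by rewrite vM// wM// !mulrDr !mulrA (mulrC k (f p)) (mulrC k (g p)) addrACA.
Qed.

HB.instance Definition _ (R : realType) (n : nat) (M : manifold R n) (p : M) :=
  GRing.isSubmodClosed.Build R ((M -> R) -> R^o) (derivation p)
    (derivation_submod_closed p).

Section tangent.
Variables (R : realType) (n : nat) (M : manifold R n) (p : M).

Record tangent := Tangent { tanv :> (M -> R) -> R^o ; _ : tanv \in derivation p }.

HB.instance Definition _ := [isSub for tanv].
HB.instance Definition _ := [Choice of tangent by <:].
HB.instance Definition _ := [SubChoice_isSubLmodule of tangent by <:].

Definition covector : {pred tangent -> R^o} := fun xi => `[< linear xi >].

Lemma covector_submod_closed : submod_closed covector.
Proof.
split; first by apply/asboolP => a u v /=; rewrite scaler0 addr0.
move=> k x y /asboolP xl /asboolP yl; apply/asboolP => a u v.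
have E w : (k *: x + y) w = k *: x w + y w by [].
by rewrite !E xl yl !scalerDr !scalerA (mulrC k a) addrACA.
Qed.

HB.instance Definition _ :=
  GRing.isSubmodClosed.Build R (tangent -> R^o) covector covector_submod_closed.

Record cotangent :=
  Cotangent { cotv :> tangent -> R^o ; _ : cotv \in covector }.

HB.instance Definition _ := [isSub for cotv].
HB.instance Definition _ := [Choice of cotangent by <:].
HB.instance Definition _ := [SubChoice_isSubLmodule of cotangent by <:].

(* Elements of wedge^a T_p M are represented by alternating multilinear functions
   on T_p^* M: the multivector A stands for the function
   (xi_1, ..., xi_a) |-> <xi_1 /\ ... /\ xi_a, A>. *)
Definition multivector (a : nat) := ('I_a -> cotangent) -> R^o.

Definition is_multivector (a : nat) (A : multivector a) : Prop :=
  (forall (xi : 'I_a -> cotangent) i k (z z' : cotangent),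
     A [eta xi with i |-> k *: z + z'] =
     k * A [eta xi with i |-> z] + A [eta xi with i |-> z']) /\
  (forall (xi : 'I_a -> cotangent) i j, i != j -> xi i = xi j -> A xi = 0).

(* v /\ B for B of degree a - 1: expansion of the determinant pairing along the
   column of v.  The result is 0 for a = 0. *)
Definition wedge_vector (a : nat) (v : tangent) (B : multivector a.-1) :
    multivector a :=
  fun xi => \sum_(k < a) (-1) ^+ k * xi k v * B (fun j => xi (lift k j)).

(* i(eta)A for a covector eta: <tau, i(eta)A> = <tau /\ eta, A>, that is, eta is
   inserted in the last slot; i(eta)A = 0 in degree a = 0. *)
Definition contract_form (a : nat) (eta : cotangent) :
    multivector a -> multivector a.-1 :=
  match a with
  | 0 => fun _ => 0
  | a'.+1 => fun A tau => A (fun k => oapp tau eta (unlift ord_max k))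
  end.

End tangent.

Section fields.
Variables (R : realType) (n : nat) (M : manifold R n).

Definition vfield := forall p : M, tangent p.
Definition covfield := forall p : M, cotangent p.
Definition mvfield (a : nat) := forall p : M, multivector p a.

Definition apply_vf (X : vfield) (f : M -> R) : M -> R := fun q => X q f.
Definition pair_form (alpha : covfield) (X : vfield) : M -> R :=
  fun q => alpha q (X q).
Definition pair_mv (a : nat) (alpha : 'I_a -> covfield) (A : mvfield a) :
  M -> R := fun q => A q (alpha ^~ q).

(* Smooth sections over an open set V: X is smooth if X f is smooth for every
   smooth f, alpha if alpha(X) is smooth for every smooth vector field X, and A
   if <alpha_1 /\ ... /\ alpha_a, A> is smooth for all smooth 1-forms alpha_i,
   where f, X, alpha_i range over the smooth objects on open subsets of V. *)

Definition vector_field (V : set M) (X : vfield) : Prop :=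
  forall (W : set M) f, open W -> W `<=` V -> smooth_on W f ->
    smooth_on W (apply_vf X f).

Definition one_form (V : set M) (alpha : covfield) : Prop :=
  forall (W : set M) X, open W -> W `<=` V -> vector_field W X ->
    smooth_on W (pair_form alpha X).

Definition multivector_field (V : set M) (a : nat) (A : mvfield a) : Prop :=
  (forall p, V p -> is_multivector (A p)) /\
  forall (W : set M) (alpha : 'I_a -> covfield), open W -> W `<=` V ->
    (forall i, one_form W (alpha i)) -> smooth_on W (pair_mv alpha A).

(* [xget 0 S] is the element of S when S is a singleton; below it picks the
   unique tangent vector, covector or multivector satisfying a defining property.

   [X,Y]_p is the tangent vector f |-> X_p(Y f) - Y_p(X f). *)
Definition bracket (X Y : vfield) : vfield := fun p =>
  xget 0 [set v : tangent p | forall f, smooth_near p f ->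
            v f = X p (apply_vf Y f) - Y p (apply_vf X f)].

(* The differential (df)_p : v |-> v f. *)
Lemma diff_subproof (p : M) (f : M -> R) :
  (fun v : tangent p => v f) \in @covector R n M p.
Proof. by apply/asboolP => k u v. Qed.

Definition diff_form (f : M -> R) : covfield := fun p =>
  Cotangent (diff_subproof p f).

(* (L_X beta)_p is the covector with
   (L_X beta)(Y) = X(beta(Y)) - beta([X,Y]) for all fields Y defined near p. *)
Definition lie_derivative (X : vfield) (beta : covfield) : covfield := fun p =>
  xget 0 [set xi : cotangent p | forall (V : set M) (Y : vfield),
            open V -> V p -> vector_field V Y ->
            xi (Y p) = X p (pair_form beta Y) - beta p (bracket X Y p)].

End fields.

Arguments vfield {R n} M.
Arguments covfield {R n} M.
Arguments mvfield {R n} M a.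

(* (d omega)(X,Y,Z) by the invariant formula. *)
Definition exterior_d2 (R : realType) (n : nat) (M : manifold R n)
    (w : forall p : M, tangent p -> tangent p -> R) (X Y Z : vfield M) : M -> R :=
  fun p =>
    X p (fun q => w q (Y q) (Z q)) - Y p (fun q => w q (X q) (Z q))
    + Z p (fun q => w q (X q) (Y q))
    - w p (bracket X Y p) (Z p) + w p (bracket X Z p) (Y p)
    - w p (bracket Y Z p) (X p).

Record symplectic_form (R : realType) (n : nat) (M : manifold R n) := Symplectic {
  symp :> forall p : M, tangent p -> tangent p -> R ;
  symp_linear : forall p k (u v w : tangent p),
    symp w (k *: u + v) = k * symp w u + symp w v ;
  symp_antisym : forall p (u v : tangent p), symp u v = - symp v u ;
  symp_smooth : forall (V : set M) (X Y : vfield M), open V ->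
    vector_field V X -> vector_field V Y ->
    smooth_on V (fun p => symp (X p) (Y p)) ;
  symp_closed : forall (V : set M) (X Y Z : vfield M), open V ->
    vector_field V X -> vector_field V Y -> vector_field V Z ->
    forall p, V p -> exterior_d2 symp X Y Z p = 0 ;
  symp_nondegenerate : forall p (u : tangent p),
    (forall v, symp u v = 0) -> u = 0 }.

Section poisson.
Variables (R : realType) (n : nat) (M : manifold R n) (w : symplectic_form M).

Lemma flat_subproof (p : M) (v : tangent p) :
  (w p v : tangent p -> R^o) \in @covector R n M p.
Proof. by apply/asboolP => k x y; apply: symp_linear. Qed.

Definition flat (p : M) (v : tangent p) : cotangent p :=
  Cotangent (flat_subproof v).

Definition sharp (p : M) (xi : cotangent p) : tangent p :=
  xget 0 [set v : tangent p | flat v = xi].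

Definition sharp_field (alpha : covfield M) : vfield M := fun p => sharp (alpha p).

(* <beta /\ alpha, Pi> = beta(sharp alpha) *)
Definition poisson_bivector : mvfield M 2 := fun p xi =>
  xi ord0 (sharp (xi ord_max)).
Arguments poisson_bivector : clear implicits.

(* [alpha,beta]_Pi; here <alpha /\ beta, Pi> = alpha(sharp beta). *)
Definition koszul_bracket (alpha beta : covfield M) : covfield M := fun p =>
  lie_derivative (sharp_field alpha) beta p
  - lie_derivative (sharp_field beta) alpha p
  + diff_form (pair_mv (fun i : 'I_2 => if i == ord0 then alpha else beta)
                 poisson_bivector) p.

(* A contravariant derivative is a local operator, so it acts on 1-forms defined
   on any open subset V of M, compatibly with restriction; it is given here with
   all these restrictions, as is needed to apply it to local coframes. *)
Record contravariant_derivative := Contravariant {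
  cder :> covfield M -> covfield M -> covfield M ;
  cder_smooth : forall (V : set M) eta alpha, open V ->
    one_form V eta -> one_form V alpha -> one_form V (cder eta alpha) ;
  cder_local : forall (V : set M) eta eta' alpha alpha', open V ->
    one_form V eta -> one_form V eta' -> one_form V alpha -> one_form V alpha' ->
    (forall p, V p -> eta p = eta' p) ->
    (forall p, V p -> alpha p = alpha' p) ->
    forall p, V p -> cder eta alpha p = cder eta' alpha' p ;
  cder_linear_r : forall (V : set M) eta alpha alpha' (k : R), open V ->
    one_form V eta -> one_form V alpha -> one_form V alpha' ->
    forall p, V p -> cder eta (fun q => k *: alpha q + alpha' q) p =
                     k *: cder eta alpha p + cder eta alpha' p ;
  cder_linear_l : forall (V : set M) eta eta' alpha (f : M -> R), open V ->
    one_form V eta -> one_form V eta' -> one_form V alpha -> smooth_on V f ->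
    forall p, V p -> cder (fun q => f q *: eta q + eta' q) alpha p =
                     f p *: cder eta alpha p + cder eta' alpha p ;
  cder_leibniz : forall (V : set M) eta alpha (f : M -> R), open V ->
    one_form V eta -> one_form V alpha -> smooth_on V f ->
    forall p, V p -> cder eta (fun q => f q *: alpha q) p =
      f p *: cder eta alpha p + sharp (eta p) f *: alpha p }.

Variable D : contravariant_derivative.

(* (D_eta A)_p is the multivector with
   <alpha_1 /\ ... /\ alpha_a, D_eta A>
     = (sharp eta) <alpha_1 /\ ... /\ alpha_a, A>
       - \sum_i <alpha_1 /\ ... /\ D_eta alpha_i /\ ... /\ alpha_a, A>
   at p, for all 1-forms alpha_i defined near p. *)
Definition cder_mv (a : nat) (eta : covfield M) (A : mvfield M a) : mvfield M a :=
  fun p => xget 0 [set B : multivector p a | is_multivector B /\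
    forall (V : set M) (alpha : 'I_a -> covfield M), open V -> V p ->
      (forall i, one_form V (alpha i)) ->
      B (alpha ^~ p) =
        sharp (eta p) (pair_mv alpha A)
        - \sum_(i < a)
            A p (fun j => if j == i then D eta (alpha i) p else alpha j p)].
Arguments cder_mv {a} eta A p _.

Definition poisson_connection : Prop :=
  forall (V : set M) eta, open V -> one_form V eta ->
    forall p, V p -> cder_mv eta poisson_bivector p = 0.

Definition torsion (alpha beta : covfield M) : covfield M := fun p =>
  D alpha beta p - D beta alpha p - koszul_bracket alpha beta p.

Definition torsion_vanishing : Prop :=
  forall (V : set M) alpha beta, open V -> one_form V alpha -> one_form V beta ->
    forall p, V p -> torsion alpha beta p = 0.

Definition curvature (a : nat) (alpha beta : covfield M) (A : mvfield M a) :
    mvfield M a := fun p =>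
  cder_mv alpha (cder_mv beta A) p - cder_mv beta (cder_mv alpha A) p
  - cder_mv (koszul_bracket alpha beta) A p.

End poisson.

Arguments poisson_bivector {R n M} w p _.
Arguments cder_mv {R n M w} D {a} eta A p _.
Arguments curvature {R n M w} D {a} alpha beta A p _.

(* The e_i are smooth on U and form a basis of the tangent space at each point
   of U. *)
Definition frame_field (R : realType) (n : nat) (M : manifold R n) (U : set M)
    (e : 'I_n -> vfield M) : Prop :=
  (forall i, vector_field U (e i)) /\
  (forall p, U p -> forall v : tangent p,
     exists! x : 'rV[R]_n, v = \sum_i x ord0 i *: e i p).

Definition dual_coframe_field (R : realType) (n : nat) (M : manifold R n)
    (U : set M) (e : 'I_n -> vfield M) (theta : 'I_n -> covfield M) : Prop :=
  (forall i, one_form U (theta i)) /\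
  (forall p, U p -> forall i j, theta i p (e j p) = (i == j)%:R).

(* Main.v *)
(**
The Poisson connection acts on covectors at a point through the endomorphisms
r(x, y) obtained from its curvature, and R_D(x, y) acts on multivectors as minus
the derivation extending r(x, y).  Since T_D = 0 and [., .]_Pi corresponds under
sharp to the Lie bracket of vector fields (because d omega = 0), r satisfies the
first Bianchi identity; since D Pi = 0, (r(x, y) (flat u)) (v) is symmetric in
u, v.

Evaluate the right-hand side on xi_1, ..., xi_a: flat e_j is inserted in the slot
k of the factor xi_k paired with e_i, and r(theta^i, theta^j) then acts on a slot
l.  For l = k, the Bianchi identity contracted with omega turns the terms into
the left-hand side.  For l <> k, the terms (k, l) and (l, k) cancel: by Bianchi
their sum is the alternating form A in the slots k, l evaluated on the tensor
sum_j flat e_j (x) r(xi_k, xi_l) theta^j, which is symmetric because D Pi = 0.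
*)

Require Import Defs.
From mathcomp Require Import all_boot all_order all_algebra perm.
From mathcomp Require Import all_classical all_reals all_analysis ring lra.
Import Order.TTheory GRing.Theory Num.Theory.
Import numFieldNormedType.Exports.

Set Implicit Arguments.
Unset Strict Implicit.
Unset Printing Implicit Defensive.

Local Open Scope classical_set_scope.
Local Open Scope ring_scope.

(** * Smooth functions *)

(** Before any object chosen by [xget] (bracket, Lie derivative, [sharp], [cder_mv]) can be computed
    with, it must be shown to exist. For the Lie derivative and [cder_mv] the reason is that the
    defining formula is linear over smooth functions in its test fields, so that it depends only on
    their values at the point. Test fields live on arbitrary open sets; they are compared after
    shrinking to an open set inside [U], where the frame expands them. In place of cut-off
    functions, a covector is extended over [U] with constant coefficients in the coframe
    ([coframe_ext]). This turns the curvature into endomorphisms [r i j] of one cotangent space, and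
    the rest is linear algebra. Origin of (-1)^a: moving the contracted covector from the last slot
    to slot k and expanding the wedge along slot k give together (-1)^(a-1); the remaining sign is
    the one in the contracted Bianchi identity. *)

Section smooth_euclid.
Variables (R : realType) (n : nat).
Implicit Types (f g : 'rV[R]_n -> R) (O : set 'rV[R]_n).

Lemma near_eq_differentiable (V W : normedModType R) (f g : V -> W) x :
  (\near x, f x = g x) -> differentiable f x -> differentiable g x.
Proof.
move=> fg df; have fgx : f x = g x by exact: nbhs_singleton fg.
have E : g \o shift x = cst (g x) + 'd f x +o_ 0 id.
  apply/eqaddoP => e e0; have /eqaddoP/(_ e e0) H := diff_locally df.
  have fg' : \forall h \near (0 : V), f (shift x h) = g (shift x h).
    by move: fg; rewrite (near_shift 0 x) subr0.
  apply: filterS2 fg' H => h /= fgh; apply: le_trans.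
  by rewrite -fgx !fctE /= fgh.
apply/diff_locallyP; rewrite (diff_unique (diff_continuous df) E).
by split => //; exact: diff_continuous.
Qed.

Lemma iter_derive_eq_on s O f g : open O -> (forall x, O x -> f x = g x) ->
  forall x, O x -> iter_derive s f x = iter_derive s g x.
Proof.
move=> oO; elim: s => //= v s IH fg x Ox; apply: near_eq_derive.
by apply: filterS (open_nbhs_nbhs (conj oO Ox)) => y; exact: IH.
Qed.

Lemma iter_derive_rcons s v f :
  iter_derive (rcons s v) f = iter_derive s ('D_v f).
Proof. by elim: s => //= u s ->. Qed.

(** Smoothness truncated at order [k]. The Leibniz rule leaves undifferentiated factors beside the
    derivatives, so closure under products is proved by induction on the order, for all functions at
    once, rather than on one word of directions. *)
Definition smooth_upto k O f := forall s x, (size s <= k)%N -> O x ->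
  differentiable (iter_derive s f) x.

Lemma smooth_upto_eq_on k O f g : open O -> (forall x, O x -> f x = g x) ->
  smooth_upto k O f -> smooth_upto k O g.
Proof.
move=> oO fg sf s x sk Ox; apply: near_eq_differentiable (sf s x sk Ox).
apply: filterS (open_nbhs_nbhs (conj oO Ox)) => y.
exact: iter_derive_eq_on.
Qed.

(** Words are split at their last letter, the derivative taken first, whereas [iter_derive] recurses
    on the first letter, the derivative taken last. *)
Lemma smooth_uptoS k O f : smooth_upto k.+1 O f <->
  (forall x, O x -> differentiable f x) /\ forall v, smooth_upto k O ('D_v f).
Proof.
split=> [sf|[sf sd] s].
  split=> [x|v s x sk]; first exact: (sf [::]).
  by rewrite -iter_derive_rcons; apply: sf; rewrite size_rcons.
case/lastP: s => [|s v] x; first by move=> _; exact: sf.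
by rewrite size_rcons ltnS iter_derive_rcons; exact: sd.
Qed.

Lemma smooth_upto0 O f :
  smooth_upto 0 O f <-> forall x, O x -> differentiable f x.
Proof.
by split=> [sf x|sf s x]; [exact: (sf [::])|rewrite leqn0 => /nilP->; exact: sf].
Qed.

Lemma smooth_uptoW k O f : smooth_upto k.+1 O f -> smooth_upto k O f.
Proof. by move=> sf s x sk; apply: sf; exact: leqW. Qed.

Lemma smooth_uptoD k O f g : open O -> smooth_upto k O f -> smooth_upto k O g ->
  smooth_upto k O (f + g).
Proof.
move=> oO; elim: k f g => [|k IH] f g.
  move=> /smooth_upto0 sf /smooth_upto0 sg; apply/smooth_upto0 => x Ox.
  by apply: differentiableD; [exact: sf|exact: sg].
move=> /smooth_uptoS[df sf] /smooth_uptoS[dg sg]; apply/smooth_uptoS; split.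
  by move=> x Ox; apply: differentiableD; [exact: df|exact: dg].
move=> v; apply: smooth_upto_eq_on (IH _ _ (sf v) (sg v)) => // x Ox.
by rewrite deriveD//; apply: diff_derivable; [exact: df|exact: dg].
Qed.

Lemma smooth_uptoM k O f g : open O -> smooth_upto k O f -> smooth_upto k O g ->
  smooth_upto k O (f * g).
Proof.
move=> oO; elim: k f g => [|k IH] f g.
  move=> /smooth_upto0 sf /smooth_upto0 sg; apply/smooth_upto0 => x Ox.
  by apply: differentiableM; [exact: sf|exact: sg].
move=> sf sg; have /smooth_uptoS[df sdf] := sf; have /smooth_uptoS[dg sdg] := sg.
apply/smooth_uptoS; split.
  by move=> x Ox; apply: differentiableM; [exact: df|exact: dg].
move=> v; apply: (@smooth_upto_eq_on _ _ (f * 'D_v g + g * 'D_v f)) => //.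
  by move=> x Ox; rewrite deriveM//; apply: diff_derivable; [exact: df|exact: dg].
by apply: smooth_uptoD => //; apply: IH => //; exact: smooth_uptoW.
Qed.

Lemma smooth_euclidP O f : smooth_euclid O f <-> forall k, smooth_upto k O f.
Proof. by split=> [sf k s x _|sf s x]; [exact: sf|exact: (sf (size s))]. Qed.

Lemma smooth_euclid_cst O (k : R) : smooth_euclid O (fun=> k).
Proof.
move=> s x _; suff [k' ->] : exists k', iter_derive s (fun=> k) = fun=> k' :> R.
  exact: differentiable_cst.
elim: s => [|v s [k' /= ->]] /=; first by exists k.
by exists 0; apply/funext => y; rewrite -(derive_cst k' y v).
Qed.

End smooth_euclid.

(** * Smooth functions on open subsets of the manifold *)

Section smooth_on.
Variables (R : realType) (n : nat) (M : manifold R n).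
Implicit Types (f g : M -> R) (V W : set M) (p : M).

Lemma atlas_is_chart (c : chart R n M) : atlas c -> is_chart c.
Proof. by case: M c => T A ? ? H ? ? c; exact: H. Qed.

(** Inside the open image of the chart domain, this set is the preimage of [V] under [param c],
    which is continuous there. *)
Lemma open_coord_image (c : chart R n M) V :
  atlas c -> open V -> open (Defs.coord c @` (dom c `&` V)).
Proof.
move=> /atlas_is_chart[od oi pK _ pc] oV; rewrite openE => _ [p [dp Vp] <-].
have ip : (Defs.coord c @` dom c) (Defs.coord c p) by exists p.
have np : nbhs (Defs.coord c p) (param c @^-1` V).
  by apply: (pc _ ip); rewrite pK//; exact: open_nbhs_nbhs.
apply: filterS2 np (open_nbhs_nbhs (conj oi ip)) => x + [q dq qx].
by rewrite -qx /= pK// => Vq; exists q.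
Qed.

Lemma param_coord_image (c : chart R n M) V x : atlas c ->
  (Defs.coord c @` (dom c `&` V)) x -> V (param c x).
Proof.
by move=> /atlas_is_chart[_ _ pK _ _] [p [dp Vp] <-]; rewrite pK.
Qed.

Lemma smooth_on_sub V W f : W `<=` V -> smooth_on V f -> smooth_on W f.
Proof.
move=> WV sf c Ac s x Wx; apply: (sf c Ac).
by apply: image_subset Wx => p [dp /WV].
Qed.

Lemma smooth_on_eq V f g : open V -> (forall p, V p -> f p = g p) ->
  smooth_on V f -> smooth_on V g.
Proof.
move=> oV fg sf c Ac; apply/smooth_euclidP => k.
apply: smooth_upto_eq_on ((smooth_euclidP _ _).1 (sf c Ac) k).
  exact: open_coord_image.
by move=> x /(param_coord_image Ac) /fg.
Qed.

Lemma smooth_on_cst V (k : R) : smooth_on V (fun=> k : R).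
Proof. by move=> c Ac; exact: smooth_euclid_cst. Qed.

Lemma smooth_onD V f g : open V -> smooth_on V f -> smooth_on V g ->
  smooth_on V (fun p => f p + g p).
Proof.
move=> oV sf sg c Ac; apply/smooth_euclidP => k; apply: smooth_uptoD.
- exact: open_coord_image.
- exact: (smooth_euclidP _ _).1 (sf c Ac) k.
- exact: (smooth_euclidP _ _).1 (sg c Ac) k.
Qed.

Lemma smooth_onM V f g : open V -> smooth_on V f -> smooth_on V g ->
  smooth_on V (fun p => f p * g p).
Proof.
move=> oV sf sg c Ac; apply/smooth_euclidP => k; apply: smooth_uptoM.
- exact: open_coord_image.
- exact: (smooth_euclidP _ _).1 (sf c Ac) k.
- exact: (smooth_euclidP _ _).1 (sg c Ac) k.
Qed.

Lemma smooth_onZ V k f : open V -> smooth_on V f -> smooth_on V (fun p => k * f p).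
Proof. by move=> oV; apply: smooth_onM => //; exact: smooth_on_cst. Qed.

Lemma smooth_onN V f : open V -> smooth_on V f -> smooth_on V (fun p => - f p).
Proof.
move=> oV /(smooth_onZ (-1) oV); apply: smooth_on_eq => // p _.
by rewrite mulN1r.
Qed.

Lemma smooth_onB V f g : open V -> smooth_on V f -> smooth_on V g ->
  smooth_on V (fun p => f p - g p).
Proof. by move=> oV sf /(smooth_onN oV); exact: smooth_onD. Qed.

Lemma smooth_on_sum V (I : Type) (r : seq I) (F : I -> M -> R) : open V ->
  (forall i, smooth_on V (F i)) -> smooth_on V (fun p => \sum_(i <- r) F i p).
Proof.
move=> oV sF; elim: r => [|i r IH].
  apply: (@smooth_on_eq _ (fun=> 0)) => // [p _|]; first by rewrite big_nil.
  exact: smooth_on_cst.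
apply: (@smooth_on_eq _ (fun p => F i p + \sum_(j <- r) F j p)) => //.
  by move=> p _; rewrite big_cons.
exact: smooth_onD.
Qed.

Lemma smooth_on_near V f p : open V -> V p -> smooth_on V f -> smooth_near p f.
Proof. by move=> *; exists V. Qed.

Lemma nbhs_subset_eq V f g p : open V -> V p -> (forall q, V q -> f q = g q) ->
  \forall q \near p, f q = g q.
Proof. by move=> oV Vp fg; apply: filterS fg (open_nbhs_nbhs (conj oV Vp)). Qed.

End smooth_on.

(** * Calculus of tangent vectors and covectors at a point *)

Section tangent_calculus.
Variables (R : realType) (n : nat) (M : manifold R n) (p : M).
Variables (V : set M) (oV : open V) (Vp : V p).
Implicit Types (f g : M -> R) (u v : tangent p) (xi eta : cotangent p).

Lemma tanP v : is_derivation p v.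
Proof. by case: v => v /= /asboolP. Qed.

Lemma tan_eq f g v : smooth_on V f -> smooth_on V g ->
  (forall q, V q -> f q = g q) -> v f = v g.
Proof.
move=> sf sg fg; have [_ vl _ _] := tanP v.
apply: vl; [exact: smooth_on_near sf|exact: smooth_on_near sg|].
exact: nbhs_subset_eq fg.
Qed.

Lemma tan_lin v k f g : smooth_on V f -> smooth_on V g ->
  v (fun q => k * f q + g q) = k * v f + v g.
Proof.
move=> sf sg; have [_ _ vl _] := tanP v.
by apply: vl; [exact: smooth_on_near sf|exact: smooth_on_near sg].
Qed.

Lemma tanM v f g : smooth_on V f -> smooth_on V g ->
  v (fun q => f q * g q) = f p * v g + g p * v f.
Proof.
move=> sf sg; have [_ _ _ vM] := tanP v.
by apply: vM; [exact: smooth_on_near sf|exact: smooth_on_near sg].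
Qed.

Lemma tanD v f g : smooth_on V f -> smooth_on V g ->
  v (fun q => f q + g q) = v f + v g.
Proof.
move=> sf sg; rewrite -[X in X + _]mul1r -tan_lin//; congr (tanv v _).
by apply/funext => q; rewrite mul1r.
Qed.

Lemma tan_cst v k : v (fun=> k : R) = 0.
Proof.
have s k' : smooth_on V (fun=> k' : R) by exact: smooth_on_cst.
have v1 : v (fun=> 1 : R) = 0.
  have := tanM v (s 1) (s 1); rewrite !mul1r => /eqP.
  by rewrite -subr_eq subrr => /eqP/esym.
have v0 : v (fun=> 0 : R) = 0.
  by have := tanM v (s 0) (s 0); rewrite !mul0r => ->; rewrite addr0.
by have := tan_lin v k (s 1) (s 0); rewrite v1 v0 mulr0 !addr0 mulr1.
Qed.

Lemma tanZ v k f : smooth_on V f -> v (fun q => k * f q) = k * v f.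
Proof.
move=> sf; have := tanM v (@smooth_on_cst _ _ M V k) sf.
by rewrite tan_cst mulr0 addr0.
Qed.

Lemma tanN v f : smooth_on V f -> v (fun q => - f q) = - v f.
Proof.
move=> sf; rewrite -mulN1r -tanZ//; congr (tanv v _).
by apply/funext => q; rewrite mulN1r.
Qed.

Lemma tanB v f g : smooth_on V f -> smooth_on V g ->
  v (fun q => f q - g q) = v f - v g.
Proof.
by move=> sf sg; rewrite tanD ?tanN//; exact: smooth_onN.
Qed.

Lemma tan_sum v (I : Type) (r : seq I) (F : I -> M -> R) :
  (forall i, smooth_on V (F i)) ->
  v (fun q => \sum_(i <- r) F i q) = \sum_(i <- r) v (F i).
Proof.
move=> sF; elim: r => [|i r IH].
  rewrite big_nil; apply: etrans (tan_cst v 0); congr (tanv v _).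
  by apply/funext => q; rewrite big_nil.
rewrite big_cons -IH -tanD//; last exact: smooth_on_sum.
by congr (tanv v _); apply/funext => q; rewrite big_cons.
Qed.

(** On functions that are not smooth near [p], both derivations are 0 by the first clause of
    [is_derivation]. *)
Lemma tangent_ext u v : (forall f, smooth_near p f -> u f = v f) -> u = v.
Proof.
move=> uv; apply/val_inj/funext => f /=.
have [|nf] := pselect (smooth_near p f); first exact: uv.
have [u0 _ _ _] := tanP u; have [v0 _ _ _] := tanP v.
by rewrite [LHS](u0 f nf) [RHS](v0 f nf).
Qed.

Lemma cotangent_ext xi eta : (forall v, xi v = eta v) -> xi = eta.
Proof. by move=> e; apply/val_inj/funext. Qed.

Lemma cot_lin xi : linear xi.
Proof. by case: xi => xi /= /asboolP. Qed.

Lemma cotD xi u v : xi (u + v) = xi u + xi v.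
Proof. by rewrite -[u in LHS]scale1r cot_lin scale1r. Qed.

Lemma cot0 xi : xi 0 = 0.
Proof. by apply: (@addrI _ (xi 0)); rewrite -cotD !addr0. Qed.

Lemma cotZ xi k u : xi (k *: u) = k * xi u.
Proof. by rewrite -[k *: u]addr0 cot_lin cot0 addr0. Qed.

Lemma cot_sum xi (I : Type) (r : seq I) (P : pred I) (F : I -> tangent p) :
  xi (\sum_(i <- r | P i) F i) = \sum_(i <- r | P i) xi (F i).
Proof. by apply: (big_morph xi) => [u v|]; [exact: cotD|exact: cot0]. Qed.

Lemma cotDE xi eta v : (xi + eta) v = xi v + eta v. Proof. by []. Qed.
Lemma cotNE xi v : (- xi) v = - xi v. Proof. by []. Qed.
Lemma cotBE xi eta v : (xi - eta) v = xi v - eta v. Proof. by []. Qed.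
Lemma cotZE k xi v : (k *: xi) v = k * xi v. Proof. by []. Qed.
Lemma tanDE u v f : (u + v) f = u f + v f. Proof. by []. Qed.
Lemma tanZE k v f : (k *: v) f = k * v f. Proof. by []. Qed.

Lemma cot_sumE (I : Type) (r : seq I) (P : pred I) (F : I -> cotangent p) v :
  (\sum_(i <- r | P i) F i) v = \sum_(i <- r | P i) F i v.
Proof. by apply: (big_morph (fun xi : cotangent p => xi v)). Qed.

End tangent_calculus.

(** * Vector fields and 1-forms *)

Section fields.
Variables (R : realType) (n : nat) (M : manifold R n).
Implicit Types (V W : set M) (X Y : vfield M) (alpha beta : covfield M).
Implicit Types (f g : M -> R).

Lemma smooth_near_sub V p f : open V -> V p -> smooth_near p f ->
  exists W, [/\ open W, W p, W `<=` V & smooth_on W f].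
Proof.
move=> oV Vp [W [oW Wp sf]]; exists (W `&` V); split;
  [exact: openI|by []|exact: subIsetr|].
by apply: smooth_on_sub sf; exact: subIsetl.
Qed.

Lemma vector_field_sub V W X : W `<=` V -> vector_field V X -> vector_field W X.
Proof. by move=> WV sX O f oO OW; apply: sX => //; exact: subset_trans WV. Qed.

Lemma one_form_sub V W alpha : W `<=` V -> one_form V alpha -> one_form W alpha.
Proof. by move=> WV sa O X oO OW; apply: sa => //; exact: subset_trans WV. Qed.

Lemma apply_vf_smooth V W X f : open W -> W `<=` V -> vector_field V X ->
  smooth_on W f -> smooth_on W (apply_vf X f).
Proof. by move=> oW WV; apply. Qed.

Lemma pair_form_smooth V alpha X : open V -> one_form V alpha ->
  vector_field V X -> smooth_on V (pair_form alpha X).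
Proof. by move=> oV sa; exact: sa. Qed.

Lemma vector_field_eq V X Y : (forall p, V p -> X p = Y p) ->
  vector_field V X -> vector_field V Y.
Proof.
move=> XY sX W f oW WV sf.
apply: (@smooth_on_eq _ _ _ _ (apply_vf X f)) => //; last exact: sX.
by move=> p /WV /XY; rewrite /apply_vf => ->.
Qed.

Lemma one_form_eq V alpha beta : (forall p, V p -> alpha p = beta p) ->
  one_form V alpha -> one_form V beta.
Proof.
move=> ab sa W X oW WV sX.
apply: (@smooth_on_eq _ _ _ _ (pair_form alpha X)) => //; last exact: sa.
by move=> p /WV /ab; rewrite /pair_form => ->.
Qed.

Lemma vector_field_lin V f X Y : smooth_on V f -> vector_field V X ->
  vector_field V Y -> vector_field V (fun q => f q *: X q + Y q).
Proof.
move=> sf sX sY W g oW WV sg.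
apply: smooth_onD (sY _ _ oW WV sg) => //.
by apply: smooth_onM (sX _ _ oW WV sg) => //; exact: smooth_on_sub sf.
Qed.

Lemma one_form_lin V f alpha beta : smooth_on V f -> one_form V alpha ->
  one_form V beta -> one_form V (fun q => f q *: alpha q + beta q).
Proof.
move=> sf sa sb W X oW WV sX.
apply: smooth_onD (sb _ _ oW WV sX) => //.
by apply: smooth_onM (sa _ _ oW WV sX) => //; exact: smooth_on_sub sf.
Qed.

Lemma vector_field0 V : vector_field V (fun=> 0).
Proof. by move=> W f oW _ _; exact: (@smooth_on_cst _ _ M W 0). Qed.

Lemma one_form0 V : one_form V (fun=> 0).
Proof. by move=> W X oW _ _; exact: (@smooth_on_cst _ _ M W 0). Qed.

Lemma one_form_scale V f alpha : smooth_on V f -> one_form V alpha ->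
  one_form V (fun q => f q *: alpha q).
Proof.
move=> sf /(one_form_lin sf)/(_ (@one_form0 V)).
by apply: one_form_eq => p _; rewrite addr0.
Qed.

Lemma one_formB V alpha beta : one_form V alpha -> one_form V beta ->
  one_form V (fun q => alpha q - beta q).
Proof.
move=> sa /(one_form_lin (@smooth_on_cst _ _ M V (-1)))/(_ sa).
by apply: one_form_eq => p _; rewrite scaleN1r addrC.
Qed.

Lemma vector_field_sum V (I : Type) (r : seq I) (f : I -> M -> R)
    (X : I -> vfield M) :
  (forall i, smooth_on V (f i)) -> (forall i, vector_field V (X i)) ->
  vector_field V (fun q => \sum_(i <- r) f i q *: X i q).
Proof.
move=> sf sX; elim: r => [|i r IH].
  by apply: vector_field_eq (@vector_field0 V) => p _; rewrite big_nil.
apply: vector_field_eq (vector_field_lin (sf i) (sX i) IH) => p _.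
by rewrite big_cons.
Qed.

Lemma one_form_sum V (I : Type) (r : seq I) (f : I -> M -> R)
    (alpha : I -> covfield M) :
  (forall i, smooth_on V (f i)) -> (forall i, one_form V (alpha i)) ->
  one_form V (fun q => \sum_(i <- r) f i q *: alpha i q).
Proof.
move=> sf sX; elim: r => [|i r IH].
  by apply: one_form_eq (@one_form0 V) => p _; rewrite big_nil.
apply: one_form_eq (one_form_lin (sf i) (sX i) IH) => p _.
by rewrite big_cons.
Qed.

End fields.

(** * The Lie bracket of vector fields *)

Section bracket.
Variables (R : realType) (n : nat) (M : manifold R n).
Implicit Types (V W : set M) (X Y Z : vfield M) (f g : M -> R).

Lemma bracket_exists V X Y p : open V -> vector_field V X -> vector_field V Y ->
  V p -> exists v : tangent p, forall f, smooth_near p f ->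
    v f = X p (apply_vf Y f) - Y p (apply_vf X f).
Proof.
move=> oV sX sY Vp.
(* The commutator, set to 0 on non-smooth functions as [is_derivation] demands. *)
pose v f : R^o := if `[< smooth_near p f >]
  then X p (apply_vf Y f) - Y p (apply_vf X f) else 0.
have vE f : smooth_near p f -> v f = X p (apply_vf Y f) - Y p (apply_vf X f).
  by move=> sf; rewrite /v asboolT.
suff dv : v \in derivation p by exists (Tangent dv).
have common f g : smooth_near p f -> smooth_near p g ->
    exists W, [/\ open W, W p, W `<=` V, smooth_on W f & smooth_on W g].
  move=> /(smooth_near_sub oV Vp)[W1 [oW1 W1p W1V sf]].
  move=> /(smooth_near_sub oW1 W1p)[W [oW Wp WW1 sg]].
  exists W; split => //; first exact: subset_trans W1V.
  exact: smooth_on_sub sf.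
apply/asboolP; split.
- by move=> f nf; rewrite /v asboolF.
- move=> f g nf ng fg; rewrite !vE//.
  have [W [oW Wp WV sf sg]] := common _ _ nf ng.
  (* The second derivatives at [p] see [f] and [g] on a whole neighbourhood, so a fixed open set on
     which they agree is needed. *)
  have [G [[oG Gp] Gfg]] : exists G, open_nbhs p G /\ G `<=` [set q | f q = g q].
    have : nbhs p [set q | f q = g q] := fg.
    by rewrite nbhsE => -[G ? ?]; exists G.
  have oWG : open (W `&` G) by exact: openI.
  have sW h : smooth_on W h -> smooth_on (W `&` G) h.
    by apply: smooth_on_sub; exact: subIsetl.
  have Zfg Z q : (W `&` G) q -> apply_vf Z f q = apply_vf Z g q.
    move=> WGq; apply: (tan_eq oWG) => //; [exact: sW|exact: sW|].
    by move=> r [_ /Gfg].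
  by congr (_ - _); apply: (tan_eq oWG) => //; try (by move=> q; exact: Zfg);
    apply: sW; exact: (apply_vf_smooth oW WV).
- move=> a f g nf ng; have [W [oW Wp WV sf sg]] := common _ _ nf ng.
  have sfg : smooth_on W (fun q => a * f q + g q).
    by apply: smooth_onD => //; exact: smooth_onZ.
  have Z1 (Z : vfield M) (u : tangent p) : vector_field V Z ->
      u (apply_vf Z (fun q => a * f q + g q)) =
      a * u (apply_vf Z f) + u (apply_vf Z g).
    move=> sZ; have s h : smooth_on W h -> smooth_on W (apply_vf Z h).
      exact: (apply_vf_smooth oW WV sZ).
    rewrite -(tan_lin oW Wp); [|exact: s|exact: s].
    apply: (tan_eq oW Wp); [exact: s| |].
      by apply: smooth_onD; [|apply: smooth_onZ|]; rewrite //; exact: s.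
    by move=> q Wq; rewrite /apply_vf (tan_lin oW Wq).
  rewrite !vE//; last exact: smooth_on_near sfg.
  by rewrite !Z1// mulrBr opprD addrACA.
- move=> f g nf ng; have [W [oW Wp WV sf sg]] := common _ _ nf ng.
  have sfg : smooth_on W (fun q => f q * g q) by exact: smooth_onM.
  have Z1 (Z : vfield M) (u : tangent p) : vector_field V Z ->
      u (apply_vf Z (fun q => f q * g q)) =
      f p * u (apply_vf Z g) + Z p g * u f + (g p * u (apply_vf Z f) + Z p f * u g).
    move=> sZ; have s h : smooth_on W h -> smooth_on W (apply_vf Z h).
      exact: (apply_vf_smooth oW WV sZ).
    rewrite -(tanM oW Wp _ sf (s _ sg)) -(tanM oW Wp _ sg (s _ sf)).
    have sfZ := smooth_onM oW sf (s _ sg); have sgZ := smooth_onM oW sg (s _ sf).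
    rewrite -(tanD oW Wp)//; apply: (tan_eq oW Wp); [exact: s|exact: smooth_onD|].
    by move=> q Wq; rewrite /apply_vf (tanM oW Wq).
  rewrite !vE//; last exact: smooth_on_near sfg.
  (* The cross terms X(f) Y(g) + Y(f) X(g) are symmetric in X and Y and cancel in the commutator. *)
  rewrite !Z1//; ring.
Qed.

Section bracket_calculus.
Variables (V : set M) (X Y : vfield M).
Hypotheses (oV : open V) (sX : vector_field V X) (sY : vector_field V Y).

Lemma bracketE p f : V p -> smooth_near p f ->
  bracket X Y p f = X p (apply_vf Y f) - Y p (apply_vf X f).
Proof.
move=> Vp; rewrite /bracket.
exact: (xgetPex 0 (bracket_exists oV sX sY Vp)).
Qed.

Lemma bracket_smooth : vector_field V (bracket X Y).
Proof.
move=> W f oW WV sf.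
apply: (@smooth_on_eq _ _ _ _
  (fun q => apply_vf X (apply_vf Y f) q - apply_vf Y (apply_vf X f) q)) => //.
  by move=> q Wq; rewrite /apply_vf bracketE//; [exact: WV|exact: smooth_on_near sf].
by apply: smooth_onB => //; do 2?apply: (apply_vf_smooth oW WV) => //.
Qed.

Lemma bracketN p : V p -> bracket X Y p = - bracket Y X p.
Proof.
move=> Vp; apply: tangent_ext => f nf; rewrite bracketE//.
rewrite -[RHS]/(- (bracket Y X p f)) -opprB; congr (- _); apply/esym.
exact: (xgetPex 0 (bracket_exists oV sY sX Vp)).
Qed.

End bracket_calculus.

Lemma bracket_eq V X X' Y Y' p : open V -> V p ->
  vector_field V X -> vector_field V X' -> vector_field V Y -> vector_field V Y' ->
  (forall q, V q -> X q = X' q) -> (forall q, V q -> Y q = Y' q) ->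
  bracket X Y p = bracket X' Y' p.
Proof.
move=> oV Vp sX sX' sY sY' XX YY; apply: tangent_ext => f nf.
rewrite (bracketE oV sX sY)// (bracketE oV sX' sY')// (XX _ Vp) (YY _ Vp).
have [W [oW Wp WV sf]] := smooth_near_sub oV Vp nf.
by congr (_ - _); apply: (tan_eq oW Wp); do ?[by apply: (apply_vf_smooth oW WV) sf];
  move=> q /WV Vq; rewrite /apply_vf ?XX ?YY.
Qed.

Lemma bracket_linr V X Y Z f p : open V -> V p -> vector_field V X ->
  vector_field V Y -> vector_field V Z -> smooth_on V f ->
  bracket X (fun q => f q *: Y q + Z q) p =
  f p *: bracket X Y p + X p f *: Y p + bracket X Z p.
Proof.
move=> oV Vp sX sY sZ sf0; apply: tangent_ext => g ng.
have sfYZ := vector_field_lin sf0 sY sZ.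
rewrite !tanDE !tanZE (bracketE oV sX sfYZ)// (bracketE oV sX sY)//.
rewrite (bracketE oV sX sZ)//.
have [W [oW Wp WV sg]] := smooth_near_sub oV Vp ng.
have s T h : vector_field V T -> smooth_on W h -> smooth_on W (apply_vf T h).
  by move=> sT; exact: (apply_vf_smooth oW WV sT).
have sf := smooth_on_sub WV sf0.
have -> : X p (apply_vf (fun q => f q *: Y q + Z q) g) =
    X p (fun q => f q * apply_vf Y g q + apply_vf Z g q) by [].
rewrite (tanD oW Wp); [|by apply: smooth_onM => //; exact: s|exact: s].
rewrite (tanM oW Wp)//; last exact: s.
rewrite tanDE tanZE /apply_vf; ring.
Qed.

Lemma jacobi V X Y Z p : open V -> V p -> vector_field V X ->
  vector_field V Y -> vector_field V Z ->
  bracket X (bracket Y Z) p + bracket Y (bracket Z X) p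
    + bracket Z (bracket X Y) p = 0.
Proof.
move=> oV Vp sX sY sZ; apply: tangent_ext => f nf.
have [W [oW Wp WV sf]] := smooth_near_sub oV Vp nf.
have s T h : vector_field V T -> smooth_on W h -> smooth_on W (apply_vf T h).
  by move=> sT; exact: (apply_vf_smooth oW WV sT).
have B T S (u : tangent p) : vector_field V T -> vector_field V S ->
    u (apply_vf (bracket T S) f) =
    u (apply_vf T (apply_vf S f)) - u (apply_vf S (apply_vf T f)).
  move=> sT sS; have sTS := s _ _ sT (s _ _ sS sf); have sST := s _ _ sS (s _ _ sT sf).
  rewrite -(tanB oW Wp)//.
  apply: (tan_eq oW Wp); [by apply: s => //; exact: bracket_smooth| |].
    exact: smooth_onB.
  by move=> q Wq; rewrite /apply_vf (bracketE oV)//; [exact: WV|exact: smooth_on_near sf].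
have C T S U : vector_field V T -> vector_field V S -> vector_field V U ->
    bracket T (bracket S U) p f =
    T p (apply_vf S (apply_vf U f)) - T p (apply_vf U (apply_vf S f))
    - (S p (apply_vf U (apply_vf T f)) - U p (apply_vf S (apply_vf T f))).
  move=> sT sS sU; rewrite (bracketE oV sT)//; last exact: bracket_smooth.
  rewrite B// (bracketE oV sS sU)//.
  by apply: (smooth_on_near oW Wp); exact: s.
rewrite !tanDE !C//.
by rewrite -[RHS]/(0 : R); ring.
Qed.

End bracket.

(** * Frames *)

Section frame.
Variables (R : realType) (n : nat) (M : manifold R n) (U : set M).
Variables (e : 'I_n -> vfield M) (theta : 'I_n -> covfield M).
Hypotheses (e_frame : frame_field U e) (theta_dual : dual_coframe_field U e theta).
Implicit Types (V : set M) (X Y : vfield M) (alpha beta : covfield M).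

Lemma frame_expand p (v : tangent p) : U p ->
  v = \sum_i theta i p v *: e i p.
Proof.
move=> Up; have [x [xv _]] := e_frame.2 p Up v.
rewrite {1}xv; apply: eq_bigr => i _; congr (_ *: _).
rewrite {1}xv cot_sum (bigD1 i)//= cotZ theta_dual.2// eqxx mulr1.
rewrite big1 ?addr0// => j ji; rewrite cotZ theta_dual.2//.
by rewrite eq_sym (negPf ji) mulr0.
Qed.

Lemma coframe_expand p (xi : cotangent p) : U p ->
  xi = \sum_i xi (e i p) *: theta i p.
Proof.
move=> Up; apply: cotangent_ext => v; rewrite cot_sumE {1}(frame_expand v Up).
by rewrite cot_sum; apply: eq_bigr => i _; rewrite cotZ cotZE mulrC.
Qed.

Lemma cotangent_ext_frame p (xi eta : cotangent p) : U p ->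
  (forall i, xi (e i p) = eta (e i p)) -> xi = eta.
Proof.
move=> Up xe; rewrite (coframe_expand xi Up) (coframe_expand eta Up).
by apply: eq_bigr => i _; rewrite xe.
Qed.

(** Extends a covector at [p] to a 1-form on [U] with constant coefficients in the coframe, hence
    linearly in the covector. *)
Definition coframe_ext p (xi : cotangent p) : covfield M := fun q =>
  \sum_i xi (e i p) *: theta i q.

Lemma coframe_extE p (xi : cotangent p) : U p -> coframe_ext xi p = xi.
Proof. by move=> Up; rewrite [RHS](coframe_expand _ Up). Qed.

Lemma frame_smooth V i : V `<=` U -> vector_field V (e i).
Proof. by move=> /vector_field_sub; apply; exact: e_frame.1. Qed.

Lemma coframe_smooth V i : V `<=` U -> one_form V (theta i).
Proof. by move=> /one_form_sub; apply; exact: theta_dual.1. Qed.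

Lemma coframe_ext_smooth V p (xi : cotangent p) : V `<=` U ->
  one_form V (coframe_ext xi).
Proof.
move=> VU; apply: one_form_sum => i; last exact: coframe_smooth.
exact: (@smooth_on_cst _ _ M V).
Qed.

Lemma coframe_ext_lin p k (xi eta : cotangent p) q :
  coframe_ext (k *: xi + eta) q = k *: coframe_ext xi q + coframe_ext eta q.
Proof.
rewrite /coframe_ext scaler_sumr -big_split; apply: eq_bigr => i _.
by rewrite cotDE cotZE scalerDl scalerA.
Qed.

Lemma bracket_frame V X (f : 'I_n -> M -> R) p (r : seq 'I_n) :
  open V -> V `<=` U -> V p -> vector_field V X -> (forall i, smooth_on V (f i)) ->
  bracket X (fun q => \sum_(i <- r) f i q *: e i q) p =
  \sum_(i <- r) (f i p *: bracket X (e i) p + X p (f i) *: e i p).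
Proof.
move=> oV VU Vp sX sf; have se i := frame_smooth i VU.
elim: r => [|i r IH].
  rewrite big_nil; apply: tangent_ext => g ng.
  have E : (fun q => \sum_(i <- [::]) f i q *: e i q) = (fun=> 0) :> vfield M.
    by apply: functional_extensionality_dep => q; rewrite big_nil.
  rewrite E (bracketE oV sX (@vector_field0 _ _ M V))// /apply_vf.
  by rewrite -[RHS](subrr 0); congr (_ - _); exact: (tan_cst oV Vp).
rewrite big_cons -IH; set Z := fun q => \sum_(i <- r) _.
rewrite -(bracket_linr oV Vp sX (se i) _ (sf i)).
  by congr (bracket X _ p); apply: functional_extensionality_dep => q; rewrite big_cons.
exact: vector_field_sum.
Qed.

(** The right-hand side is linear over smooth functions in [Y]: when [Y] is multiplied by f, the
    term X(f) beta(Y) from the Leibniz rule cancels the one from the bracket. It is therefore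
    determined by its values on the frame, from which the witness covector is built. *)
Lemma lie_derivativeE V X beta Y p : open V -> V `<=` U -> V p ->
  vector_field V X -> one_form V beta -> vector_field V Y ->
  lie_derivative X beta p (Y p) =
    X p (pair_form beta Y) - beta p (bracket X Y p).
Proof.
move=> oV VU Vp sX sb sY; have se i := frame_smooth i VU.
have Up := VU _ Vp.
pose S := [set xi : cotangent p | forall (W : set M) (Y : vfield M),
            open W -> W p -> vector_field W Y ->
            xi (Y p) = X p (pair_form beta Y) - beta p (bracket X Y p)].
suff [xi Sxi] : exists xi, S xi by exact: (xgetPex 0 (ex_intro S xi Sxi) V).
exists (\sum_i (X p (pair_form beta (e i)) - beta p (bracket X (e i) p))
         *: theta i p).
move=> W0 Z oW0 W0p sZ0; pose W := W0 `&` V.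
have oW : open W by exact: openI.
have WV : W `<=` V by exact: subIsetr.
have WU : W `<=` U by exact: subset_trans VU.
have Wp : W p by [].
have sZ : vector_field W Z by apply: vector_field_sub sZ0; exact: subIsetl.
have sXW := vector_field_sub WV sX; have sbW := one_form_sub WV sb.
pose f i q := theta i q (Z q).
have sf i : smooth_on W (f i).
  by apply: (pair_form_smooth oW _ sZ); exact: coframe_smooth.
have sfe : vector_field W (fun q => \sum_i f i q *: e i q).
  by apply: vector_field_sum => // i; exact: frame_smooth.
have Zfe q : W q -> Z q = \sum_i f i q *: e i q.
  by move=> /WU; exact: frame_expand.
have sbe i : smooth_on W (pair_form beta (e i)).
  by apply: pair_form_smooth => //; exact: frame_smooth.
rewrite (bracket_eq oW Wp sXW sXW sZ sfe (fun _ _ => erefl) Zfe).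
rewrite (bracket_frame _ oW WU Wp sXW sf).
have -> : X p (pair_form beta Z) =
    X p (fun q => \sum_i f i q * pair_form beta (e i) q).
  apply: (tan_eq oW Wp).
  - exact: pair_form_smooth.
  - by apply: smooth_on_sum => // i; exact: smooth_onM.
  - move=> q Wq; rewrite /pair_form (Zfe q Wq) cot_sum.
    by apply: eq_bigr => i _; rewrite cotZ.
rewrite (tan_sum oW Wp)//; last by move=> i; exact: smooth_onM.
rewrite cot_sum cot_sumE -sumrB; apply: eq_bigr => i _.
rewrite cotZE -/(f i p) (tanM oW Wp)// cotD !cotZ /pair_form; ring.
Qed.

End frame.

(** * The musical isomorphisms and the Koszul bracket *)

Section sharp.
Variables (R : realType) (n : nat) (M : manifold R n) (U : set M).
Variables (e : 'I_n -> vfield M) (theta : 'I_n -> covfield M).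
Hypotheses (e_frame : frame_field U e) (theta_dual : dual_coframe_field U e theta).
Variables (w : symplectic_form M) (D : contravariant_derivative w).
Implicit Types (V : set M) (X Y : vfield M) (alpha beta : covfield M).

Let expand := frame_expand e_frame theta_dual.

Lemma flatE p (u v : tangent p) : flat w u v = w p u v. Proof. by []. Qed.

Lemma flatN p (u v : tangent p) : flat w u v = - flat w v u.
Proof. exact: symp_antisym. Qed.

Lemma flat_lin p k (u v : tangent p) :
  flat w (k *: u + v) = k *: flat w u + flat w v.
Proof.
apply: cotangent_ext => z; rewrite cotDE cotZE flatN cotD cotZ.
by rewrite (flatN u) (flatN v) mulrN opprD.
Qed.

Lemma flatD p (u v : tangent p) : flat w (u + v) = flat w u + flat w v.
Proof. by rewrite -[u in LHS]scale1r flat_lin scale1r. Qed.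

Lemma flat0 p : flat w (0 : tangent p) = 0.
Proof. by apply: (@addrI _ (flat w (0 : tangent p))); rewrite -flatD !addr0. Qed.

Lemma flat_opp p (u : tangent p) : flat w (- u) = - flat w u.
Proof. by rewrite -scaleN1r -[_ *: _]addr0 flat_lin flat0 addr0 scaleN1r. Qed.

Lemma flat_inj p (u v : tangent p) : flat w u = flat w v -> u = v.
Proof.
move=> uv; apply/eqP; rewrite -subr_eq0; apply/eqP.
apply: (symp_nondegenerate (s := w)) => z.
by rewrite -flatE flatD flat_opp uv subrr.
Qed.

(** Nondegeneracy only gives injectivity; the frame makes [flat] a square matrix [A], whose trivial
    kernel makes it invertible. *)
Lemma flat_surj p (xi : cotangent p) : U p -> exists v, flat w v = xi.
Proof.
move=> Up; pose A := \matrix_(i < n, j < n) w p (e i p) (e j p).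
have xA (x : 'rV_n) j : (x *m A) ord0 j = flat w (\sum_i x ord0 i *: e i p) (e j p).
  rewrite flatN cot_sum -sumrN mxE; apply: eq_bigr => i _.
  by rewrite mxE cotZ -mulrN -flatN.
have uA : A \in unitmx.
  rewrite -row_free_unit -kermx_eq0; apply/eqP/row_matrixP => k.
  rewrite row0; set x := row k _.
  have xA0 : x *m A = 0 by rewrite -row_mul mulmx_ker row0.
  have x0 : \sum_i x ord0 i *: e i p = 0.
    apply: (symp_nondegenerate (s := w)) => v; rewrite -flatE (expand v Up).
    by rewrite cot_sum big1// => j _; rewrite cotZ -xA xA0 mxE mulr0.
  (* Both [x] and the zero row are coordinates of the zero vector, and coordinates are unique. *)
  have [y [_ uy]] := e_frame.2 p Up 0.
  rewrite -(uy x (esym x0)); apply: uy.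
  by rewrite big1// => i _; rewrite mxE scale0r.
exists (\sum_i ((\row_j xi (e j p)) *m invmx A) ord0 i *: e i p).
apply: (cotangent_ext_frame e_frame theta_dual Up) => j.
by rewrite -xA mulmxKV// mxE.
Qed.

Lemma sharpK p (xi : cotangent p) : U p -> flat w (sharp w xi) = xi.
Proof. by move=> /(flat_surj xi); exact: xgetPex. Qed.

Lemma flatK p (v : tangent p) : sharp w (flat w v) = v.
Proof. by apply: xget_unique => // u; exact: flat_inj. Qed.

Lemma sharp_lin p k (xi eta : cotangent p) : U p ->
  sharp w (k *: xi + eta) = k *: sharp w xi + sharp w eta.
Proof. by move=> Up; apply: flat_inj; rewrite flat_lin !sharpK. Qed.

Lemma sharpN p (xi eta : cotangent p) : U p -> xi (sharp w eta) = - eta (sharp w xi).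
Proof.
by move=> Up; rewrite -{1}(sharpK xi Up) flatN sharpK.
Qed.

(** Smoothness is read off from [D]: by the Leibniz rule (sharp alpha) f is the pairing of D_alpha
    (f theta^i) - f D_alpha theta^i with e_i, and [D] sends smooth 1-forms to smooth 1-forms. *)
Lemma sharp_field_smooth V alpha : open V -> V `<=` U -> one_form V alpha ->
  vector_field V (sharp_field w alpha).
Proof.
move=> oV VU sa0 W f oW WV sf; have WU := subset_trans WV VU.
have sa := one_form_sub WV sa0.
(* In dimension 0 there is no index [i]; then all tangent vectors vanish. *)
case: (pickP (fun _ : 'I_n => true)) => [i _|n0]; last first.
  apply: (@smooth_on_eq _ _ _ _ (fun=> 0 : R)) => // q Wq; last first.
    exact: smooth_on_cst.
  rewrite /apply_vf (expand (sharp_field w alpha q) (WU _ Wq)) big1// => i.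
  by have := n0 i.
have st := coframe_smooth theta_dual i WU.
have se := frame_smooth e_frame i WU.
(* Leibniz rule for f theta^i, paired with e_i. *)
apply: (@smooth_on_eq _ _ _ _ (fun q =>
  pair_form (D alpha (fun q => f q *: theta i q)) (e i) q
  - f q * pair_form (D alpha (theta i)) (e i) q)) => //.
  move=> q Wq; rewrite /pair_form (@cder_leibniz _ _ _ _ D W)// cotDE !cotZE.
  by rewrite theta_dual.2 ?eqxx ?mulr1; [rewrite addrC addKr|exact: WU].
have sft := one_form_scale sf st.
apply: smooth_onB => //; last apply: smooth_onM => //.
- by apply: pair_form_smooth => //; exact: cder_smooth.
- by apply: pair_form_smooth => //; exact: cder_smooth.
Qed.

Lemma flat_field_smooth V X : vector_field V X ->
  one_form V (fun q => flat w (X q)).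
Proof.
move=> sX W Y oW WV sY; apply: symp_smooth => //.
exact: vector_field_sub sX.
Qed.

(** Write alpha = flat X and beta = flat Y and pair with a frame field Z: the difference of the two
    sides is the six-term formula for (d omega)(X, Y, Z). *)
Lemma koszul_bracketE V alpha beta p : open V -> V `<=` U -> V p ->
  one_form V alpha -> one_form V beta ->
  koszul_bracket w alpha beta p =
  flat w (bracket (sharp_field w alpha) (sharp_field w beta) p).
Proof.
move=> oV VU Vp sa sb; have Up := VU _ Vp.
have sX := sharp_field_smooth oV VU sa.
have sY := sharp_field_smooth oV VU sb.
set X := sharp_field w alpha in sX *; set Y := sharp_field w beta in sY *.
apply: (cotangent_ext_frame e_frame theta_dual Up) => i.
have sZ := frame_smooth e_frame i VU; set Z := e i in sZ *.
have aE q : V q -> alpha q = flat w (X q) by move=> /VU Uq; rewrite sharpK.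
have bE q : V q -> beta q = flat w (Y q) by move=> /VU Uq; rewrite sharpK.
rewrite cotDE cotBE !(lie_derivativeE e_frame theta_dual oV VU Vp)//.
have pairE (u : tangent p) gamma T S : one_form V gamma -> vector_field V T ->
    vector_field V S -> (forall q, V q -> gamma q = flat w (T q)) ->
    u (pair_form gamma S) = u (fun q => w q (T q) (S q)).
  move=> sg sT sS gE; apply: (tan_eq oV Vp);
    [exact: pair_form_smooth|exact: symp_smooth|].
  by move=> q Vq; rewrite /pair_form gE.
rewrite (pairE _ _ _ _ sb sY sZ bE) (pairE _ _ _ _ sa sX sZ aE).
have -> : diff_form (pair_mv (fun i0 : 'I_2 => if i0 == ord0 then alpha else beta)
    (poisson_bivector w)) p (Z p) = Z p (fun q => w q (X q) (Y q)).
  rewrite -(pairE _ _ _ _ sa sX sY aE) /diff_form /=.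
  by congr (tanv (Z p) _).
rewrite (aE p Vp) (bE p Vp) !flatE.
have := symp_closed w oV sX sY sZ Vp; rewrite /exterior_d2 => dw.
rewrite (symp_antisym w (Y p) (bracket X Z p)).
rewrite (symp_antisym w (X p) (bracket Y Z p)).
rewrite -/X -/Y; apply/subr0_eq; rewrite -[RHS]dw; ring.
Qed.

Lemma koszul_bracket_smooth V alpha beta : open V -> V `<=` U ->
  one_form V alpha -> one_form V beta -> one_form V (koszul_bracket w alpha beta).
Proof.
move=> oV VU sa sb.
apply: (one_form_eq (alpha := fun q =>
  flat w (bracket (sharp_field w alpha) (sharp_field w beta) q))).
  by move=> q Vq; rewrite (koszul_bracketE oV VU Vq).
by apply: flat_field_smooth; apply: bracket_smooth => //; exact: sharp_field_smooth.
Qed.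

Lemma sharp_koszul V alpha beta p : open V -> V `<=` U -> V p ->
  one_form V alpha -> one_form V beta ->
  sharp w (koszul_bracket w alpha beta p) =
  bracket (sharp_field w alpha) (sharp_field w beta) p.
Proof. by move=> oV VU Vp sa sb; rewrite (koszul_bracketE oV VU Vp)// flatK. Qed.

Lemma koszul_bracketN V alpha beta p : open V -> V `<=` U -> V p ->
  one_form V alpha -> one_form V beta ->
  koszul_bracket w alpha beta p = - koszul_bracket w beta alpha p.
Proof.
move=> oV VU Vp sa sb; have sX := sharp_field_smooth oV VU sa.
have sY := sharp_field_smooth oV VU sb.
rewrite !(koszul_bracketE oV VU Vp)// (bracketN oV sX sY Vp).
exact: flat_opp.
Qed.

Lemma koszul_jacobi V alpha beta gamma p : open V -> V `<=` U -> V p ->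
  one_form V alpha -> one_form V beta -> one_form V gamma ->
  koszul_bracket w alpha (koszul_bracket w beta gamma) p
  + koszul_bracket w beta (koszul_bracket w gamma alpha) p
  + koszul_bracket w gamma (koszul_bracket w alpha beta) p = 0.
Proof.
move=> oV VU Vp sa sb sc.
have sk a b := @koszul_bracket_smooth V a b oV VU.
have ss a := @sharp_field_smooth V a oV VU.
have K a b c : one_form V a -> one_form V b -> one_form V c ->
    koszul_bracket w a (koszul_bracket w b c) p =
    flat w (bracket (sharp_field w a)
      (bracket (sharp_field w b) (sharp_field w c)) p).
  move=> fa fb fc; rewrite (koszul_bracketE oV VU Vp)//; last exact: sk.
  congr flat; apply: (bracket_eq oV Vp) => //; do ?[exact: ss].
  - by apply: ss; exact: sk.
  - by apply: bracket_smooth => //; exact: ss.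
  - by move=> q Vq; rewrite /sharp_field (sharp_koszul oV VU Vq).
by rewrite !K// -!flatD (jacobi oV Vp) ?flat0//; exact: ss.
Qed.

End sharp.

(** * Multivectors and contravariant derivatives *)

Section slot.
Variables (T : Type) (a : nat).
Implicit Types (xi : 'I_a -> T) (i j : 'I_a).

(** Convertible with the updated tuples in [is_multivector] and [cder_mv]. The type [T] is left open
    because tuples of covectors and tuples of 1-forms are both updated. *)
Definition slot xi i (z : T) : 'I_a -> T := fun j => if j == i then z else xi j.

Lemma slot_id xi i : slot xi i (xi i) = xi.
Proof. by apply/funext => j; rewrite /slot; case: eqP => [->|]. Qed.

Lemma slot_slot xi i z z' : slot (slot xi i z) i z' = slot xi i z'.
Proof. by apply/funext => j; rewrite /slot; case: eqP. Qed.

Lemma slotC xi i j z z' : i != j ->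
  slot (slot xi i z) j z' = slot (slot xi j z') i z.
Proof.
move=> ij; apply/funext => k; rewrite /slot; case: (eqVneq k j) => // ->.
by rewrite eq_sym (negPf ij).
Qed.

Lemma slotE xi i z : slot xi i z i = z.
Proof. by rewrite /slot eqxx. Qed.

Lemma slotNE xi i j z : j != i -> slot xi i z j = xi j.
Proof. by rewrite /slot => /negPf->. Qed.

End slot.

(** * Alternating multilinear functions at a point *)

Section multivector.
Variables (R : realType) (n : nat) (M : manifold R n) (p : M) (a : nat).
Variables (A : multivector p a) (mA : is_multivector A).
Implicit Types (xi : 'I_a -> cotangent p) (x y z : cotangent p).

Lemma mv_lin xi i k x y :
  A (slot xi i (k *: x + y)) = k * A (slot xi i x) + A (slot xi i y).
Proof. exact: mA.1. Qed.

Lemma mv_alternating xi i j : i != j -> xi i = xi j -> A xi = 0.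
Proof. exact: mA.2. Qed.

Lemma mvD xi i x y : A (slot xi i (x + y)) = A (slot xi i x) + A (slot xi i y).
Proof. by rewrite -[x in LHS]scale1r mv_lin mul1r. Qed.

Lemma mv_slot0 xi i : A (slot xi i 0) = 0.
Proof. by apply: (@addrI _ (A (slot xi i 0))); rewrite -mvD !addr0. Qed.

Lemma mvZ xi i k x : A (slot xi i (k *: x)) = k * A (slot xi i x).
Proof. by rewrite -[k *: x]addr0 mv_lin mv_slot0 addr0. Qed.

Lemma mvN xi i x : A (slot xi i (- x)) = - A (slot xi i x).
Proof. by rewrite -scaleN1r mvZ mulN1r. Qed.

Lemma mvB xi i x y : A (slot xi i (x - y)) = A (slot xi i x) - A (slot xi i y).
Proof. by rewrite mvD mvN. Qed.

Lemma mv_sum xi i (I : Type) (r : seq I) (P : pred I) (F : I -> cotangent p) :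
  A (slot xi i (\sum_(k <- r | P k) F k)) =
  \sum_(k <- r | P k) A (slot xi i (F k)).
Proof.
apply: (big_morph (fun z => A (slot xi i z))) => [x y|]; first exact: mvD.
exact: mv_slot0.
Qed.

Lemma mv_swap xi i j x y : i != j ->
  A (slot (slot xi i x) j y) = - A (slot (slot xi i y) j x).
Proof.
move=> ij; have two z : A (slot (slot xi i z) j z) = 0.
  by apply: (mv_alternating ij); rewrite slotE slotNE// slotE.
have := two (x + y); rewrite mvD !(slotC _ _ _ ij) !mvD.
rewrite -!(slotC _ _ _ ij) !two add0r addr0 addrC => /eqP.
by rewrite addr_eq0 => /eqP.
Qed.

Lemma mv_tperm xi i j : i != j -> A (fun k => xi (tperm i j k)) = - A xi.
Proof.
move=> ij; have -> : A xi = A (slot (slot xi i (xi i)) j (xi j)) by rewrite !slot_id.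
rewrite mv_swap// opprK; congr A; apply/funext => k; rewrite /slot.
case: tpermP => [->|->|/eqP/negPf ki /eqP/negPf kj]; last by rewrite ki kj.
  by rewrite eqxx (negPf ij).
by rewrite eqxx.
Qed.

Lemma mv_perm xi (s : {perm 'I_a}) : A (fun k => xi (s k)) = (-1) ^+ s * A xi.
Proof.
have [ts -> /=] := prod_tpermP s; elim: ts xi => [|[i j] ts IH] xi /=.
  move=> _; rewrite big_nil odd_perm1 mul1r; congr A.
  by apply/funext => k; rewrite perm1.
move=> /andP[ij dts]; rewrite big_cons odd_mul_tperm ij signr_addb expr1.
rewrite -mulrA mulN1r -IH// -(@mv_tperm (fun k => xi _) i j ij).
by congr A; apply/funext => k; rewrite permM.
Qed.

End multivector.

(** * The contravariant derivative of a multivector field *)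

Section contravariant.
Variables (R : realType) (n : nat) (M : manifold R n) (U : set M).
Variables (e : 'I_n -> vfield M) (theta : 'I_n -> covfield M).
Hypotheses (e_frame : frame_field U e) (theta_dual : dual_coframe_field U e theta).
Variables (w : symplectic_form M) (D : contravariant_derivative w).
Implicit Types (V W : set M) (X Y : vfield M) (alpha beta eta : covfield M).

Lemma multivector_field_sub V W a (A : mvfield M a) : W `<=` V ->
  multivector_field V A -> multivector_field W A.
Proof.
move=> WV [mA sA]; split=> [q /WV|O al oO OW]; first exact: mA.
by apply: sA => //; exact: subset_trans WV.
Qed.

Lemma pair_mv_smooth V a (A : mvfield M a) (al : 'I_a -> covfield M) : open V ->
  multivector_field V A -> (forall i, one_form V (al i)) ->
  smooth_on V (pair_mv al A).
Proof. by move=> oV [_ sA]; exact: sA. Qed.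

Lemma slot_form a (al : 'I_a -> covfield M) i eta q :
  (slot al i eta) ^~ q = slot (al ^~ q) i (eta q).
Proof. by apply/funext => j; rewrite /slot; case: eqP. Qed.

Lemma slot_smooth V a (al : 'I_a -> covfield M) i eta :
  (forall i, one_form V (al i)) -> one_form V eta ->
  forall j, one_form V (slot al i eta j).
Proof. by move=> sal se j; rewrite /slot; case: eqP. Qed.

Lemma cder_lin V eta alpha beta (f : M -> R) p : open V -> V p ->
  one_form V eta -> one_form V alpha -> one_form V beta -> smooth_on V f ->
  D eta (fun q => f q *: alpha q + beta q) p =
  f p *: D eta alpha p + sharp w (eta p) f *: alpha p + D eta beta p.
Proof.
move=> oV Vp se sa sb sf; rewrite -(@cder_leibniz _ _ _ _ D V)//.
rewrite -[D eta _ p in RHS]scale1r -(@cder_linear_r _ _ _ _ D V)//.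
  by congr (D eta _ p); apply: functional_extensionality_dep => q; rewrite scale1r.
exact: one_form_scale.
Qed.

(* The value at p of the right-hand side of the definition of D_eta A. *)
Definition cder_pair a eta (A : mvfield M a) (al : 'I_a -> covfield M) (p : M) : R :=
  sharp w (eta p) (pair_mv al A)
  - \sum_(i < a) A p (slot (al ^~ p) i (D eta (al i) p)).

Section cder_pair.
Variables (V : set M) (eta : covfield M) (a : nat) (A : mvfield M a) (p : M).
Hypotheses (oV : open V) (VU : V `<=` U) (Vp : V p).
Hypotheses (se : one_form V eta) (sA : multivector_field V A).
Implicit Types (al : 'I_a -> covfield M).
Arguments A : clear implicits.

Let mA : is_multivector (A p) := sA.1 p Vp.

Lemma cder_pair_eq al al' : (forall i, one_form V (al i)) ->
  (forall i, one_form V (al' i)) -> (forall i q, V q -> al i q = al' i q) ->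
  cder_pair eta A al p = cder_pair eta A al' p.
Proof.
move=> sal sal' E.
have E' q : V q -> al ^~ q = al' ^~ q by move=> Vq; apply/funext => i; exact: E.
congr (_ - _).
  apply: (tan_eq oV Vp); do ?exact: pair_mv_smooth.
  by move=> q Vq; rewrite /pair_mv E'.
apply: eq_bigr => i _; rewrite E'//; congr (A p (slot _ _ _)).
by apply: (@cder_local _ _ _ _ D V) => // q; exact: E.
Qed.

(** The term (sharp eta)(f) produced by differentiating the pairing cancels the one produced by the
    Leibniz rule of [D eta] in slot [i]. This is what makes the extended derivative well defined. *)
Lemma cder_pair_lin al i (f : M -> R) alpha beta : (forall i, one_form V (al i)) ->
  one_form V alpha -> one_form V beta -> smooth_on V f ->
  cder_pair eta A (slot al i (fun q => f q *: alpha q + beta q)) p =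
  f p * cder_pair eta A (slot al i alpha) p + cder_pair eta A (slot al i beta) p.
Proof.
move=> sal sa sb sf.
have sfab := one_form_lin sf sa sb.
have sma := pair_mv_smooth oV sA (slot_smooth i sal sa).
have smb := pair_mv_smooth oV sA (slot_smooth i sal sb).
have -> : cder_pair eta A (slot al i (fun q => f q *: alpha q + beta q)) p =
    (f p * sharp w (eta p) (pair_mv (slot al i alpha) A)
     + A p (slot (al ^~ p) i (alpha p)) * sharp w (eta p) f
     + sharp w (eta p) (pair_mv (slot al i beta) A))
    - \sum_l A p (slot ((slot al i (fun q => f q *: alpha q + beta q)) ^~ p) l
       (D eta (slot al i (fun q => f q *: alpha q + beta q) l) p)).
  congr (_ - _).
  have -> : A p (slot (al ^~ p) i (alpha p)) = pair_mv (slot al i alpha) A p.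
    by rewrite /pair_mv slot_form.
  rewrite -(tanM oV Vp)// -(tanD oV Vp)//; last exact: smooth_onM.
  apply: (tan_eq oV Vp).
  - by apply: pair_mv_smooth => //; exact: slot_smooth.
  - by apply: smooth_onD => //; exact: smooth_onM.
  - by move=> q Vq; rewrite /pair_mv !slot_form (mv_lin (sA.1 q Vq)).
suff -> : \sum_l A p (slot ((slot al i (fun q => f q *: alpha q + beta q)) ^~ p) l
       (D eta (slot al i (fun q => f q *: alpha q + beta q) l) p)) =
    f p * (\sum_l A p (slot ((slot al i alpha) ^~ p) l (D eta (slot al i alpha l) p)))
    + \sum_l A p (slot ((slot al i beta) ^~ p) l (D eta (slot al i beta l) p))
    + A p (slot (al ^~ p) i (alpha p)) * sharp w (eta p) f.
  by rewrite /cder_pair; ring.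
(* Only the term l = i involves the Leibniz rule; in the others [f p] just comes out of slot [i]. *)
have term l : l != i ->
    A p (slot ((slot al i (fun q => f q *: alpha q + beta q)) ^~ p) l
       (D eta (slot al i (fun q => f q *: alpha q + beta q) l) p)) =
    f p * A p (slot ((slot al i alpha) ^~ p) l (D eta (slot al i alpha l) p))
    + A p (slot ((slot al i beta) ^~ p) l (D eta (slot al i beta l) p)).
  move=> li; have il : i != l by rewrite eq_sym.
  by rewrite !(slotNE _ _ li) !slot_form !(slotC _ _ _ il) mv_lin.
rewrite (bigD1 i)// [in RHS](bigD1 i)// [X in _ = _ + X + _](bigD1 i)//.
rewrite (eq_bigr _ term) big_split -mulr_sumr !slotE !slot_form !slot_slot.
rewrite (cder_lin oV Vp)// !(mvD mA) !(mvZ mA) /=.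
ring.
Qed.

Let slot0 al i : (forall i, one_form V (al i)) ->
  cder_pair eta A (slot al i (fun=> 0)) p = 0.
Proof.
move=> sal; have s0 := @one_form0 _ _ M V.
have := cder_pair_lin i sal s0 s0 (@smooth_on_cst _ _ M V 1).
have -> : (fun q => 1 *: 0 + 0) = (fun=> 0) :> covfield M.
  by apply: functional_extensionality_dep => q; rewrite scale1r addr0.
by rewrite mul1r => /eqP; rewrite -subr_eq subrr => /eqP/esym.
Qed.

Lemma cder_pair_slot al i beta : (forall i, one_form V (al i)) ->
  one_form V beta ->
  cder_pair eta A (slot al i beta) p =
  \sum_k beta p (e k p) * cder_pair eta A (slot al i (theta k)) p.
Proof.
move=> sal sb; have st k := coframe_smooth theta_dual k VU.
pose f k q := beta q (e k q).
have sf k : smooth_on V (f k).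
  by apply: (pair_form_smooth oV sb); exact: (frame_smooth e_frame k VU).
have sfr r := one_form_sum r sf st.
rewrite (@cder_pair_eq _ (slot al i (fun q => \sum_k f k q *: theta k q))).
- elim: (index_enum _) => [|k r IH].
    rewrite big_nil -(slot0 i sal); congr (cder_pair _ _ (slot al i _) p).
    by apply: functional_extensionality_dep => q; rewrite big_nil.
  rewrite big_cons -IH -(cder_pair_lin _ sal (st k) (sfr r) (sf k)).
  congr (cder_pair _ _ (slot al i _) p).
  by apply: functional_extensionality_dep => q; rewrite big_cons.
- exact: slot_smooth.
- exact: slot_smooth.
- move=> j q Vq; rewrite /slot; case: eqP => // _.
  exact: (coframe_expand e_frame theta_dual _ (VU Vq)).
Qed.

(** The forms are replaced one slot at a time; [h s] is the tuple in which the slots listed in [s]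
    have been replaced. By [cder_pair_slot] each replacement involves only the value of the new form
    at [p]. *)
Lemma cder_pair_tensor al al' : (forall i, one_form V (al i)) ->
  (forall i, one_form V (al' i)) -> (forall i, al i p = al' i p) ->
  cder_pair eta A al p = cder_pair eta A al' p.
Proof.
move=> sal sal' E.
pose h (s : seq 'I_a) j := if j \in s then al' j else al j.
have sh s j : one_form V (h s j) by rewrite /h; case: ifP.
have hp s j : h s j p = al' j p by rewrite /h; case: ifP.
suff H s : cder_pair eta A (h s) p = cder_pair eta A al p.
  rewrite -(H (enum 'I_a)); congr (cder_pair _ _ _ p); apply/funext => j.
  by rewrite /h mem_enum.
elim: s => [|i s <-]; first by congr (cder_pair _ _ _ p); apply/funext.
have -> : h (i :: s) = slot (h s) i (al' i).
  apply/funext => j; rewrite /h /slot in_cons.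
  by case: (eqVneq j i) => [->|].
rewrite -[in RHS](slot_id (h s) i) !(@cder_pair_slot _ _ _ (sh s))//.
by apply: eq_bigr => k _; rewrite hp.
Qed.

End cder_pair.

Section cder_mv.
Variables (V : set M) (eta : covfield M) (a : nat) (A : mvfield M a).
Hypotheses (oV : open V) (VU : V `<=` U).
Hypotheses (se : one_form V eta) (sA : multivector_field V A).
Arguments A : clear implicits.

(** The witness evaluates [cder_pair] on constant-coefficient extensions of the covectors;
    [cder_pair_tensor] shows that any other choice of forms with the same values at [p] gives the
    same result. *)
Lemma cder_mv_spec p : V p -> is_multivector (cder_mv D eta A p) /\
  forall (W : set M) (al : 'I_a -> covfield M), open W -> W p ->
    (forall i, one_form W (al i)) ->
    cder_mv D eta A p (al ^~ p) = cder_pair eta A al p.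
Proof.
move=> Vp; pose S := [set B : multivector p a | is_multivector B /\
    forall (W : set M) (alpha : 'I_a -> covfield M), open W -> W p ->
      (forall i, one_form W (alpha i)) ->
      B (alpha ^~ p) = cder_pair eta A alpha p].
suff [B SB] : exists B, S B by exact: (xgetPex 0 (ex_intro S B SB)).
pose ext (xi : 'I_a -> cotangent p) j := coframe_ext e theta (xi j).
have sext xi W : W `<=` U -> forall j, one_form W (ext xi j).
  by move=> WU j; exact: (coframe_ext_smooth theta_dual (xi j) WU).
exists (fun xi => cder_pair eta A (ext xi) p); split.
  split=> [xi i k z z'|xi i j ij xiij].
    have ext_slot x : ext (slot xi i x) = slot (ext xi) i (coframe_ext e theta x).
      by apply/funext => j; rewrite /ext /slot; case: eqP.
    rewrite -![in LHS]/(slot xi i _) -![in RHS]/(slot xi i _) !ext_slot.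
    have sx (x : cotangent p) := coframe_ext_smooth theta_dual x VU.
    rewrite -(cder_pair_lin oV Vp se sA i (sext xi V VU) (sx z) (sx z')
      (@smooth_on_cst _ _ M V k)).
    congr (cder_pair _ _ (slot _ i _) p); apply: functional_extensionality_dep => q.
    exact: coframe_ext_lin.
  have extij : ext xi i = ext xi j by rewrite /ext xiij.
  rewrite /cder_pair.
  have -> : sharp w (eta p) (pair_mv (ext xi) A) = 0.
    rewrite -(tan_cst oV Vp (sharp w (eta p)) 0); apply: (tan_eq oV Vp).
    - by apply: pair_mv_smooth => //; exact: sext.
    - exact: (@smooth_on_cst _ _ M V).
    - by move=> q Vq; apply: (mv_alternating (sA.1 q Vq) ij); rewrite extij.
  have mA := sA.1 p Vp; have ji : j != i by rewrite eq_sym.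
  (* For l other than i and j, slots i and j still hold equal covectors. The two remaining terms are
     opposite by [mv_swap]. *)
  rewrite (bigD1 i)// (bigD1 j)//= big1 ?addr0 => [|l /andP[li lj]]; last first.
    apply: (mv_alternating mA ij); rewrite !slotNE 1?eq_sym//.
    by rewrite extij.
  set x := D eta (ext xi j) p; rewrite extij -/x.
  set z := ext xi ^~ p; have zij : z i = z j by rewrite /z extij.
  have -> : A p (slot z i x) = - A p (slot z j x).
    rewrite -{1}(slot_id z j) (slotC _ _ _ ji) (mv_swap mA _ _ _ ij).
    by rewrite -zij slot_id.
  by rewrite addNr subr0.
move=> W al oW Wp sal; pose Q := W `&` V.
have oQ : open Q by exact: openI.
have QV : Q `<=` V by exact: subIsetr.
have QW : Q `<=` W by exact: subIsetl.
have QU : Q `<=` U by exact: subset_trans VU.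
have Qp : Q p by [].
apply: (cder_pair_tensor oQ QU Qp (one_form_sub QV se) (multivector_field_sub QV sA)).
- exact: sext.
- by move=> i; exact: one_form_sub (sal i).
- by move=> i; exact: (coframe_extE e_frame theta_dual (al i p) (VU Vp)).
Qed.

Lemma cder_mvE p (al : 'I_a -> covfield M) : V p -> (forall i, one_form V (al i)) ->
  cder_mv D eta A p (al ^~ p) = cder_pair eta A al p.
Proof. by move=> Vp; apply: (cder_mv_spec Vp).2. Qed.

End cder_mv.

End contravariant.

(** * Curvature *)

Section curvature.
Variables (R : realType) (n : nat) (M : manifold R n) (U : set M).
Variables (e : 'I_n -> vfield M) (theta : 'I_n -> covfield M).
Hypotheses (e_frame : frame_field U e) (theta_dual : dual_coframe_field U e theta).
Variables (w : symplectic_form M) (D : contravariant_derivative w).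
Variables (V : set M).
Hypotheses (oV : open V) (VU : V `<=` U).
Implicit Types (alpha beta gamma eta : covfield M).

Let sharp_smooth alpha := sharp_field_smooth e_frame theta_dual D oV VU (alpha := alpha).
Let koszul_smooth alpha beta :=
  koszul_bracket_smooth e_frame theta_dual D oV VU (alpha := alpha) (beta := beta).

Definition form_curvature alpha beta gamma : covfield M := fun p =>
  D alpha (D beta gamma) p - D beta (D alpha gamma) p
  - D (koszul_bracket w alpha beta) gamma p.

Lemma cder_mv_smooth eta a (A : mvfield M a) : one_form V eta ->
  multivector_field V A -> multivector_field V (cder_mv D eta A).
Proof.
move=> se sA; split=> [p Vp|W al oW WV sal].
  exact: (cder_mv_spec e_frame theta_dual D oV VU se sA Vp).1.
have WU := subset_trans WV VU.
have seW := one_form_sub WV se; have sAW := multivector_field_sub WV sA.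
have sD i : one_form W (D eta (al i)) by exact: cder_smooth.
apply: (@smooth_on_eq _ _ _ _ (fun q =>
  apply_vf (sharp_field w eta) (pair_mv al A) q
  - \sum_i pair_mv (slot al i (D eta (al i))) A q)) => //.
  move=> q Wq; rewrite [RHS](cder_mvE e_frame theta_dual D oW WU)//.
  by congr (_ - _); apply: eq_bigr => i _; rewrite /pair_mv slot_form.
apply: smooth_onB => //.
  apply: (sharp_smooth se oW WV); exact: pair_mv_smooth.
apply: smooth_on_sum => // i; apply: pair_mv_smooth => //; exact: slot_smooth.
Qed.

(* R_D acts on multivectors as minus the derivation extending its action on
   covectors: the terms in which each of alpha and beta differentiates a different
   factor cancel by symmetry. *)
Lemma curvature_mvE alpha beta a (A : mvfield M a) (al : 'I_a -> covfield M) p :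
  V p -> one_form V alpha -> one_form V beta -> multivector_field V A ->
  (forall i, one_form V (al i)) ->
  curvature D alpha beta A p (al ^~ p) =
  - \sum_i A p (slot (al ^~ p) i (form_curvature alpha beta (al i) p)).
Proof.
move=> Vp sa sb sA sal.
pose X := sharp_field w.
pose f := pair_mv al A.
(* In the expansion of D_eta (D_zeta A), [S] collects the terms that differentiate one form twice,
   [T] those that differentiate two forms, and [Q] those that also differentiate the pairing. In [S]
   the order is reversed, first [eta], then [zeta]: this is the source of the minus sign. The [Q]
   terms enter symmetrically and drop out. *)
pose S eta zeta : R := \sum_i A p (slot (al ^~ p) i (D zeta (D eta (al i)) p)).
pose T eta zeta : R := \sum_i \sum_(l < a | l != i)
  A p (slot (slot (al ^~ p) i (D eta (al i) p)) l (D zeta (al l) p)).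
pose Q eta zeta : R := \sum_i X eta p (pair_mv (slot al i (D zeta (al i))) A).
have sf : smooth_on V f by exact: pair_mv_smooth.
have sD eta i : one_form V eta -> one_form V (D eta (al i)).
  by move=> se; exact: cder_smooth.
have second eta zeta : one_form V eta -> one_form V zeta ->
    cder_mv D eta (cder_mv D zeta A) p (al ^~ p) =
    X eta p (apply_vf (X zeta) f) - Q eta zeta - Q zeta eta
    + (S eta zeta + T eta zeta).
  move=> se sz; have sDA := cder_mv_smooth sz sA.
  rewrite (cder_mvE e_frame theta_dual D oV VU se sDA Vp)// /cder_pair.
  have -> : sharp w (eta p) (pair_mv al (cder_mv D zeta A)) =
      X eta p (apply_vf (X zeta) f) - Q eta zeta.
    have s1 : smooth_on V (apply_vf (X zeta) f).
      by apply: sharp_smooth.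
    have s2 i : smooth_on V (pair_mv (slot al i (D zeta (al i))) A).
      by apply: pair_mv_smooth => //; apply: slot_smooth => //; exact: sD.
    have s3 := smooth_on_sum (index_enum 'I_a) oV s2.
    rewrite /Q -(tan_sum oV Vp)// -(tanB oV Vp)//; apply: (tan_eq oV Vp).
    - exact: pair_mv_smooth.
    - exact: smooth_onB.
    - move=> q Vq; rewrite /pair_mv (cder_mvE e_frame theta_dual D oV VU sz sA Vq)//.
      by congr (_ - _); apply: eq_bigr => i _; rewrite slot_form.
  suff -> : \sum_i cder_mv D zeta A p (slot (al ^~ p) i (D eta (al i) p)) =
      Q zeta eta - (S eta zeta + T eta zeta) by ring.
  rewrite -big_split -sumrB; apply: eq_bigr => i _.
  have sli := slot_smooth i sal (sD eta i se).
  rewrite -slot_form (cder_mvE e_frame theta_dual D oV VU sz sA Vp)//.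
  congr (_ - _); rewrite (bigD1 i)// slotE slot_form slot_slot; congr (_ + _).
  by apply: eq_bigr => l li; rewrite slotNE.
have TC : T alpha beta = T beta alpha.
  rewrite /T; rewrite (exchange_big_dep predT)//=; apply: eq_bigr => l _.
  apply: eq_big => [i|i il]; first by rewrite eq_sym.
  by rewrite slotC// eq_sym.
have sk := koszul_smooth sa sb.
rewrite [LHS](_ : _ = cder_mv D alpha (cder_mv D beta A) p (al ^~ p)
  - cder_mv D beta (cder_mv D alpha A) p (al ^~ p)
  - cder_mv D (koszul_bracket w alpha beta) A p (al ^~ p))//.
rewrite !second// TC (cder_mvE e_frame theta_dual D oV VU sk sA Vp)// /cder_pair.
(* The derivative of the pairing along the Koszul bracket becomes one along the Lie bracket, which
   cancels the commutator of the two directional derivatives. *)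
rewrite (sharp_koszul e_frame theta_dual D oV VU Vp)//.
rewrite (bracketE oV (sharp_smooth sa) (sharp_smooth sb) Vp); last first.
  exact: (smooth_on_near oV Vp).
have -> : \sum_i A p (slot (al ^~ p) i (form_curvature alpha beta (al i) p)) =
    S beta alpha - S alpha beta
    - \sum_i A p (slot (al ^~ p) i (D (koszul_bracket w alpha beta) (al i) p)).
  by rewrite -!sumrB; apply: eq_bigr => i _; rewrite !(mvB (sA.1 p Vp)).
rewrite /f /X; ring.
Qed.

Lemma cderB_r eta alpha beta p : V p -> one_form V eta -> one_form V alpha ->
  one_form V beta ->
  D eta (fun q => alpha q - beta q) p = D eta alpha p - D eta beta p.
Proof.
move=> Vp se sa sb; rewrite addrC -scaleN1r -(@cder_linear_r _ _ _ _ D V)//.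
congr (D eta _ p); apply: functional_extensionality_dep => q.
by rewrite scaleN1r addrC.
Qed.

(** Linearity with the constant function 1 and two zero forms gives x = x + x. *)
Lemma cder0_l alpha p : V p -> one_form V alpha -> D (fun=> 0) alpha p = 0.
Proof.
move=> Vp sa; have s0 := @one_form0 _ _ M V.
have := @cder_linear_l _ _ _ _ D V _ _ _ (fun=> 1) oV s0 s0 sa
  (@smooth_on_cst _ _ M V 1) p Vp.
have -> : (fun q => 1 *: 0 + 0) = (fun=> 0) :> covfield M.
  by apply: functional_extensionality_dep => q; rewrite scale1r addr0.
by rewrite scale1r => /eqP; rewrite -subr_eq subrr => /eqP/esym.
Qed.

Lemma cderN_l eta alpha p : V p -> one_form V eta -> one_form V alpha ->
  D (fun q => - eta q) alpha p = - D eta alpha p.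
Proof.
move=> Vp se sa; have s0 := @one_form0 _ _ M V.
have := @cder_linear_l _ _ _ _ D V _ _ _ (fun=> -1) oV se s0 sa
  (@smooth_on_cst _ _ M V (-1)) p Vp.
rewrite cder0_l// scaleN1r addr0 => <-; congr (D _ _ p).
by apply: functional_extensionality_dep => q; rewrite scaleN1r addr0.
Qed.

Lemma form_curvatureN alpha beta gamma p : V p -> one_form V alpha ->
  one_form V beta -> one_form V gamma ->
  form_curvature alpha beta gamma p = - form_curvature beta alpha gamma p.
Proof.
move=> Vp sa sb sc; rewrite /form_curvature.
have skab := koszul_smooth sa sb; have skba := koszul_smooth sb sa.
suff -> : D (koszul_bracket w alpha beta) gamma p =
    - D (koszul_bracket w beta alpha) gamma p.
  by rewrite opprK !opprD !opprK (addrC (- _)).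
rewrite -cderN_l//; apply: (@cder_local _ _ _ _ D V) => //.
  have := one_form_scale (@smooth_on_cst _ _ M V (-1)) skba.
  by apply: one_form_eq => q _; rewrite scaleN1r.
by move=> q Vq; rewrite (koszul_bracketN e_frame theta_dual D oV VU Vq).
Qed.

(** Constant coefficients match [coframe_ext_lin]: the curvature at a point is evaluated on
    constant-coefficient extensions. *)
Lemma form_curvature_lin alpha beta (k : R) gamma gamma' p : V p ->
  one_form V alpha -> one_form V beta -> one_form V gamma -> one_form V gamma' ->
  form_curvature alpha beta (fun q => k *: gamma q + gamma' q) p =
  k *: form_curvature alpha beta gamma p + form_curvature alpha beta gamma' p.
Proof.
move=> Vp sa sb sc sc'.
have lin1 eta : one_form V eta -> forall q, V q ->
    D eta (fun q => k *: gamma q + gamma' q) q = k *: D eta gamma q + D eta gamma' q.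
  by move=> se q Vq; rewrite (@cder_linear_r _ _ _ _ D V).
have slin : one_form V (fun q => k *: gamma q + gamma' q).
  by apply: one_form_lin => //; exact: (@smooth_on_cst _ _ M V).
have sD eta zeta : one_form V eta -> one_form V zeta -> one_form V (D eta zeta).
  exact: cder_smooth.
have lin2 eta zeta : one_form V eta -> one_form V zeta ->
    D eta (D zeta (fun q => k *: gamma q + gamma' q)) p =
    k *: D eta (D zeta gamma) p + D eta (D zeta gamma') p.
  move=> se sz; rewrite -(@cder_linear_r _ _ _ _ D V)//; do ?exact: sD.
  apply: (@cder_local _ _ _ _ D V) => //; [exact: sD| |exact: lin1].
  by apply: one_form_lin; [exact: (@smooth_on_cst _ _ M V)|exact: sD|exact: sD].
rewrite /form_curvature !lin2// lin1//; last exact: koszul_smooth.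
by rewrite !scalerBr !opprD (addrACA (k *: D alpha (D beta gamma) p)) [LHS]addrACA.
Qed.

(** * The first Bianchi identity *)

Section torsion_free.
Hypothesis D_torsion : torsion_vanishing D.

Lemma koszul_cder alpha beta p : V p -> one_form V alpha -> one_form V beta ->
  koszul_bracket w alpha beta p = D alpha beta p - D beta alpha p.
Proof. by move=> Vp sa sb; have /subr0_eq := D_torsion oV sa sb Vp. Qed.

(** Without torsion, [x, [y, z]] equals D_x D_y z - D_x D_z y - D_[y,z] x. Summed cyclically, these
    nine terms are those of the three curvatures, and the Jacobi identity makes the sum 0. *)
Lemma first_bianchi alpha beta gamma p : V p ->
  one_form V alpha -> one_form V beta -> one_form V gamma ->
  form_curvature alpha beta gamma p + form_curvature beta gamma alpha p
  + form_curvature gamma alpha beta p = 0.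
Proof.
move=> Vp sa sb sc.
have sD eta zeta : one_form V eta -> one_form V zeta -> one_form V (D eta zeta).
  exact: cder_smooth.
have K x y z : one_form V x -> one_form V y -> one_form V z ->
    koszul_bracket w x (koszul_bracket w y z) p =
    D x (D y z) p - D x (D z y) p - D (koszul_bracket w y z) x p.
  move=> sx sy sz; have sk := koszul_smooth sy sz.
  rewrite koszul_cder//; congr (_ - _); rewrite -cderB_r//; do ?exact: sD.
  apply: (@cder_local _ _ _ _ D V) => //.
    by apply: one_formB; exact: sD.
  by move=> q Vq; exact: koszul_cder.
rewrite -[RHS](koszul_jacobi e_frame theta_dual D oV VU Vp sa sb sc) !K//.
rewrite /form_curvature.
by apply: cotangent_ext => v; rewrite !(cotDE, cotNE); ring.
Qed.

End torsion_free.

Lemma poisson_bivector_smooth : multivector_field V (poisson_bivector w).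
Proof.
split=> [p /VU Up|W al oW WV sal].
  have ord2 (i : 'I_2) : i = ord0 \/ i = ord_max.
    by case: i => -[|[|//]] i2; [left|right]; exact: val_inj.
  split=> [xi i k z z'|xi i j ij xiij].
    rewrite /poisson_bivector; case: (ord2 i) => -> //=.
    by rewrite (sharp_lin e_frame theta_dual)// cotD cotZ.
  have E : xi ord0 = xi ord_max.
    by move: ij xiij; case: (ord2 i) => ->; case: (ord2 j) => ->; rewrite ?eqxx.
  (* Antisymmetry of xi(sharp eta) at equal arguments shows that the value is its own opposite. *)
  rewrite /poisson_bivector E; apply/eqP; rewrite -eqNr.
  by rewrite -(sharpN e_frame theta_dual).
apply: (pair_form_smooth (X := sharp_field w (al ord_max)) oW (sal ord0)).
apply: (sharp_field_smooth e_frame theta_dual D) => //.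
exact: subset_trans VU.
Qed.

(** The curvature annihilates Pi, so [curvature_mvE] gives (r gamma)(sharp delta) + gamma(sharp (r
    delta)) = 0, where r is the curvature on forms; [sharpN] turns the second term into -(r
    delta)(sharp gamma). *)
Lemma form_curvature_sym alpha beta gamma delta p : poisson_connection D -> V p ->
  one_form V alpha -> one_form V beta -> one_form V gamma -> one_form V delta ->
  form_curvature alpha beta gamma p (sharp w (delta p)) =
  form_curvature alpha beta delta p (sharp w (gamma p)).
Proof.
move=> D_poisson Vp sa sb sc sd; have Up := VU Vp.
have sPi := poisson_bivector_smooth.
pose al (i : 'I_2) := if i == ord0 then gamma else delta.
have sal i : one_form V (al i) by rewrite /al; case: ifP.
have Pi0 eta q : one_form V eta -> V q -> cder_mv D eta (poisson_bivector w) q = 0.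
  by move=> se Vq; exact: (D_poisson V).
have second eta zeta : one_form V eta -> one_form V zeta ->
    cder_mv D eta (cder_mv D zeta (poisson_bivector w)) p (al ^~ p) = 0.
  move=> se sz; have sDP := cder_mv_smooth sz sPi.
  rewrite (cder_mvE e_frame theta_dual D oV VU se sDP)// /cder_pair.
  (* The sum needs D_zeta Pi = 0 at [p] only; the derivative of the pairing needs it on all of
     [V]. *)
  rewrite big1 ?subr0 => [|i _]; last by rewrite Pi0.
  rewrite -(tan_cst oV Vp (sharp w (eta p)) 0); apply: (tan_eq oV Vp).
  - exact: pair_mv_smooth.
  - exact: (@smooth_on_cst _ _ M V).
  - by move=> q Vq; rewrite /pair_mv Pi0.
have := curvature_mvE Vp sa sb sPi sal.
rewrite [X in X = _ -> _](_ : _ =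
  cder_mv D alpha (cder_mv D beta (poisson_bivector w)) p (al ^~ p)
  - cder_mv D beta (cder_mv D alpha (poisson_bivector w)) p (al ^~ p)
  - cder_mv D (koszul_bracket w alpha beta) (poisson_bivector w) p (al ^~ p))//.
rewrite !second// Pi0//; last exact: koszul_smooth.
rewrite !subr0 big_ord_recl big_ord1 /poisson_bivector /slot /al /=.
rewrite (sharpN e_frame theta_dual w (gamma p))// => /eqP.
by rewrite eq_sym oppr_eq0 subr_eq0 => /eqP.
Qed.

End curvature.

(** * The pointwise identity *)

Lemma sum_symmetric (n : nat) (V : zmodType) (F : 'I_n -> 'I_n -> V) :
  (forall i j, F i j = F j i) -> (forall i, F i i = 0) ->
  \sum_i \sum_j F i j = (\sum_(i < n) \sum_(j < n | (i < j)%N) F i j) *+ 2.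
Proof.
move=> sF F0; rewrite mulr2n.
rewrite [X in _ = _ + X](exchange_big_dep predT)//= -big_split.
apply: eq_bigr => i _ /=; rewrite (bigID (fun j : 'I_n => (i < j)%N))/=.
congr (_ + _); rewrite (bigID (fun j : 'I_n => j == i))/= [X in X + _]big1 ?add0r.
  by apply: eq_big => [j|j _]; [rewrite -leqNgt -val_eqE ltn_neqAle andbC|exact: sF].
by move=> j /andP[_ /eqP->].
Qed.

(** [contract_form] fills the last slot. The permutation that moves it to slot k and keeps the order
    of the others is a cycle of sign (-1)^(a+k); multiplied by the (-1)^k of [wedge_vector] it
    leaves (-1)^a, in degree a + 1. *)
Lemma mv_insert (R : realType) (n : nat) (M : manifold R n) (p : M) (a : nat)
    (B : multivector p a.+1) (xi : 'I_a.+1 -> cotangent p) k eta :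
  is_multivector B ->
  contract_form (a := a.+1) eta B (fun j => xi (lift k j)) =
  (-1) ^+ (a + k) * B (slot xi k eta).
Proof.
move=> mB; rewrite /contract_form.
have -> : (fun m => oapp (fun j => xi (lift k j)) eta (unlift ord_max m)) =
          (fun m => slot xi k eta (lift_perm ord_max k 1%g m)).
  apply/funext => m; case: unliftP => [j ->|->] /=.
    by rewrite lift_perm_lift perm1 slotNE// eq_sym neq_lift.
  by rewrite lift_perm_id slotE.
rewrite (mv_perm mB) odd_lift_perm odd_perm1 addbF; congr (_ * _).
by rewrite signr_addb !signr_odd exprD.
Qed.

Section pointwise.
Variables (R : realType) (n : nat) (M : manifold R n) (U : set M).
Variables (e : 'I_n -> vfield M) (theta : 'I_n -> covfield M).
Hypotheses (e_frame : frame_field U e) (theta_dual : dual_coframe_field U e theta).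
Variables (w : symplectic_form M) (p : M).
Hypothesis (Up : U p).
(** [r i j] stands for the curvature endomorphism of theta^i and theta^j. Antisymmetry and Bianchi
    are assumed on the coframe; [r_expand] carries them to all covectors. *)
Variable r : 'I_n -> 'I_n -> cotangent p -> cotangent p.
Hypothesis r_lin : forall i j k x y, r i j (k *: x + y) = k *: r i j x + r i j y.
Hypothesis r_anti : forall i j k, r i j (theta k p) = - r j i (theta k p).
Hypothesis r_bianchi : forall i j k,
  r i j (theta k p) + r j k (theta i p) + r k i (theta j p) = 0.
Hypothesis r_sym : forall i j u v, r i j (flat w u) v = r i j (flat w v) u.
Implicit Types (x y z : cotangent p) (u v : tangent p) (i j : 'I_n).

Notation E i := (e i p).
Notation T i := (theta i p).
Notation W i j := (w p (E i) (E j)).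

Lemma rD i j x y : r i j (x + y) = r i j x + r i j y.
Proof. by rewrite -[x in LHS]scale1r r_lin scale1r. Qed.

Lemma r0 i j : r i j 0 = 0.
Proof. by apply: (@addrI _ (r i j 0)); rewrite -rD !addr0. Qed.

Lemma rZ i j c x : r i j (c *: x) = c *: r i j x.
Proof. by rewrite -[c *: x]addr0 r_lin r0 addr0. Qed.

Lemma r_sum i j (F : 'I_n -> cotangent p) :
  r i j (\sum_k F k) = \sum_k r i j (F k).
Proof. by apply: (big_morph (r i j)) => [x y|]; [exact: rD|exact: r0]. Qed.

Lemma r_expand i j x : r i j x = \sum_k x (E k) *: r i j (T k).
Proof.
rewrite {1}(coframe_expand e_frame theta_dual x Up) r_sum.
by apply: eq_bigr => k _; rewrite rZ.
Qed.

Lemma flat_frame j : flat w (E j) = \sum_k W j k *: T k.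
Proof. exact: (coframe_expand e_frame theta_dual). Qed.

Lemma symp_frame_anti i j : W i j = - W j i.
Proof. exact: symp_antisym. Qed.

(** Contract Bianchi with x(e_i) omega(e_j, e_k). Two of the three cyclic sums equal the left-hand
    side [S], and the third is the full double sum of [F], which is twice the sum over i < j. Hence
    2 S + 2 (sum over i < j) = 0. *)
Lemma ricci_identity x :
  \sum_i \sum_j x (E i) *: r i j (flat w (E j)) =
  - \sum_(i < n) \sum_(j < n | (i < j)%N) W i j *: r i j x.
Proof.
apply: cotangent_ext => v; rewrite cotNE.
pose F i j := (W i j *: r i j x) v.
have rA i j : r i j x = - r j i x.
  rewrite !(r_expand _ _ x) -sumrN; apply: eq_bigr => k _.
  by rewrite r_anti scalerN.
have Fs : \sum_i \sum_j F i j = (\sum_(i < n) \sum_(j < n | (i < j)%N) F i j) *+ 2.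
  apply: sum_symmetric => [i j|i]; rewrite /F.
    by rewrite symp_frame_anti rA scaleNr scalerN opprK.
  have : W i i = - W i i by exact: symp_frame_anti.
  by move/eqP; rewrite eq_sym eqNr => /eqP->; rewrite scale0r.
pose S := \sum_i \sum_j \sum_k x (E i) * (W j k * r i j (T k) v).
have -> : (\sum_i \sum_j x (E i) *: r i j (flat w (E j))) v = S.
  rewrite cot_sumE; apply: eq_bigr => i _; rewrite cot_sumE; apply: eq_bigr => j _.
  rewrite cotZE flat_frame r_sum cot_sumE mulr_sumr; apply: eq_bigr => k _.
  by rewrite rZ cotZE.
have -> : (\sum_(i < n) \sum_(j < n | (i < j)%N) W i j *: r i j x) v =
    \sum_(i < n) \sum_(j < n | (i < j)%N) F i j.
  by rewrite cot_sumE; apply: eq_bigr => i _; rewrite cot_sumE.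
suff : S + S + \sum_i \sum_j F i j = 0 by rewrite Fs mulr2n => ?; lra.
have FE : \sum_i \sum_j F i j = \sum_i \sum_j \sum_k x (E i) * (W j k * r j k (T i) v).
  rewrite [RHS]exchange_big; apply: eq_bigr => j _.
  rewrite [RHS]exchange_big; apply: eq_bigr => k _.
  rewrite /F cotZE r_expand cot_sumE mulr_sumr; apply: eq_bigr => i _.
  by rewrite cotZE mulrCA.
(* Exchanging j and k, the sign of omega(e_j, e_k) compensates the one from the antisymmetry of
   [r]. *)
have SE : S = \sum_i \sum_j \sum_k x (E i) * (W j k * r k i (T j) v).
  apply: eq_bigr => i _; rewrite exchange_big; apply: eq_bigr => k _.
  apply: eq_bigr => j _; rewrite r_anti cotNE symp_frame_anti; ring.
rewrite {2}SE FE -!big_split big1// => i _; rewrite -!big_split big1// => j _.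
rewrite -!big_split big1// => k _ /=; rewrite -!mulrDr.
have := congr1 (fun z : cotangent p => z v) (r_bianchi i j k).
rewrite !cotDE addrAC => ->; by rewrite !mulr0.
Qed.

Section transposed.
Variable B : cotangent p -> cotangent p -> R.
Hypothesis B_linl : forall c x y z, B (c *: x + y) z = c * B x z + B y z.
Hypothesis B_anti : forall x y, B x y = - B y x.

Lemma B_linr c x y z : B z (c *: x + y) = c * B z x + B z y.
Proof. by rewrite B_anti B_linl (B_anti z x) (B_anti z y) mulrN opprD. Qed.

Lemma B_sumr z (I : Type) (s : seq I) (c : I -> R) (F : I -> cotangent p) :
  B z (\sum_(i <- s) c i *: F i) = \sum_(i <- s) c i * B z (F i).
Proof.
elim: s => [|i s IH]; last by rewrite !big_cons B_linr IH.
have B0 : B z 0 = 0.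
  apply: (@addrI _ (B z 0)); have := B_linr 1 0 0 z.
  by rewrite scaler0 addr0 mul1r => {1}<-; rewrite addr0.
by rewrite !big_nil.
Qed.

Lemma B_suml z (I : Type) (s : seq I) (c : I -> R) (F : I -> cotangent p) :
  B (\sum_(i <- s) c i *: F i) z = \sum_(i <- s) c i * B (F i) z.
Proof.
rewrite B_anti B_sumr -sumrN; apply: eq_bigr => i _.
by rewrite (B_anti z) mulrN opprK.
Qed.

(** To be used with [B] equal to [A] in two slots k <> l, the others frozen, and with x and y the
    covectors in these slots: the two summands are then the (k, l) and (l, k) terms, the minus sign
    coming from [mv_swap]. *)
Lemma transposed_terms_cancel x y :
  \sum_i \sum_j (x (E i) * B (flat w (E j)) (r i j y)
                - y (E i) * B (flat w (E j)) (r i j x)) = 0.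
Proof.
(* The curvature endomorphism r(x, y), bilinear in x and y. *)
pose rho z := \sum_i \sum_k (x (E i) * y (E k)) *: r i k z.
have rho_sum (c : 'I_n -> R) (F : 'I_n -> cotangent p) :
    rho (\sum_j c j *: F j) = \sum_j c j *: rho (F j).
  rewrite /rho; under [RHS]eq_bigr do rewrite scaler_sumr.
  rewrite [RHS]exchange_big; apply: eq_bigr => i _.
  under [RHS]eq_bigr do rewrite scaler_sumr.
  rewrite [RHS]exchange_big; apply: eq_bigr => k _.
  rewrite r_sum scaler_sumr; apply: eq_bigr => j _.
  by rewrite rZ !scalerA mulrC.
(* Bianchi for x, y, theta^j: r(x, theta^j) y - r(y, theta^j) x = r(x, y) theta^j. *)
have rhoT j : \sum_i (x (E i) *: r i j y - y (E i) *: r i j x) = rho (T j).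
  rewrite sumrB /rho.
  have -> : \sum_i y (E i) *: r i j x =
      \sum_i \sum_k (x (E i) * y (E k)) *: r k j (T i).
    rewrite [RHS]exchange_big; apply: eq_bigr => k _.
    rewrite r_expand scaler_sumr; apply: eq_bigr => i _.
    by rewrite scalerA mulrC.
  rewrite -sumrB; apply: eq_bigr => i _.
  rewrite r_expand scaler_sumr -sumrB; apply: eq_bigr => k _.
  rewrite scalerA -scalerBr; congr (_ *: _).
  rewrite (r_anti k) opprK (r_anti i k); apply/eqP; rewrite -addr_eq0; apply/eqP.
  exact: r_bianchi.
have rho_sym u v : rho (flat w u) v = rho (flat w v) u.
  rewrite /rho !cot_sumE; apply: eq_bigr => i _; rewrite !cot_sumE.
  by apply: eq_bigr => k _; rewrite !cotZE r_sym.
have -> : \sum_i \sum_j (x (E i) * B (flat w (E j)) (r i j y)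
                - y (E i) * B (flat w (E j)) (r i j x)) =
    \sum_j B (flat w (E j)) (rho (T j)).
  rewrite exchange_big; apply: eq_bigr => j _; rewrite -rhoT sumrB.
  rewrite -!B_sumr -mulN1r addrC -B_linr scaleN1r addrC sumrB.
  by [].
(* Expanding [flat] in the coframe moves it to the other argument, where [rho_sym] applies;
   antisymmetry of omega gives the sign. *)
have -> : \sum_j B (flat w (E j)) (rho (T j)) = - \sum_i B (T i) (rho (flat w (E i))).
  rewrite -sumrN; under eq_bigr do rewrite flat_frame B_suml.
  rewrite exchange_big; apply: eq_bigr => i _.
  rewrite flat_frame rho_sum B_sumr -sumrN; apply: eq_bigr => j _.
  by rewrite symp_frame_anti mulNr.
pose G i j := rho (flat w (E i)) (E j) * B (T i) (T j).
have GE : \sum_i B (T i) (rho (flat w (E i))) = \sum_i \sum_j G i j.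
  apply: eq_bigr => i _.
  by rewrite {1}(coframe_expand e_frame theta_dual (rho _) Up) B_sumr.
(* A symmetric coefficient times the antisymmetric B(theta^i, theta^j). *)
suff : \sum_i \sum_j G i j = - \sum_i \sum_j G i j.
  by rewrite GE => ?; lra.
rewrite {1}exchange_big -sumrN; apply: eq_bigr => i _; rewrite -sumrN.
by apply: eq_bigr => j _; rewrite /G rho_sym B_anti mulrN.
Qed.

End transposed.

Lemma curvature_identity a (A : multivector p a)
    (RA : 'I_n -> 'I_n -> multivector p a) : is_multivector A ->
  (forall i j, is_multivector (RA i j)) ->
  (forall i j xi, RA i j xi = - \sum_l A (slot xi l (r i j (xi l)))) ->
  (-1) ^+ a *: \sum_(i < n) \sum_(j < n | (i < j)%N) W i j *: RA i j =
  \sum_(i < n) \sum_(j < n)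
    wedge_vector (E i) (contract_form (flat w (E j)) (RA i j)).
Proof.
move=> mA mRA RAE; apply/funext => xi.
have ev (I : Type) (s : seq I) (P : pred I) (F : I -> multivector p a) :
    (\sum_(i <- s | P i) F i) xi = \sum_(i <- s | P i) F i xi.
  by apply: (big_morph (fun B : multivector p a => B xi)).
rewrite -[LHS]/((-1) ^+ a * (\sum_(i < n) \sum_(j < n | (i < j)%N) W i j *: RA i j) xi).
rewrite !ev; under [X in _ * X]eq_bigr do rewrite ev.
under [RHS]eq_bigr do rewrite ev.
(* In degree 0 both sides vanish: the wedge is an empty sum, and so is the derivation in [RAE]. *)
case: a A RA mA mRA RAE xi ev => [|a] A RA mA mRA RAE xi _.
  rewrite big1 ?mulr0 => [|i _]; last first.
    by rewrite big1// => j _; rewrite -[LHS]/(W i j * RA i j xi) RAE big_ord0 oppr0 mulr0.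
  by rewrite big1// => i _; rewrite big1// => j _; rewrite /wedge_vector big_ord0.
pose eta j := flat w (E j).
(* Slot k receives flat e_j and the curvature acts on slot l. [C] collects the cross terms l <> k;
   [P] is what the diagonal terms become through [ricci_identity]. *)
pose Z (k l : 'I_a.+1) i j := xi k (E i) * A (slot (slot xi k (eta j)) l (r i j (xi l))).
pose C := \sum_k \sum_(l < a.+1 | l != k) \sum_i \sum_j Z k l i j.
pose L (k : 'I_a.+1) := \sum_(i < n) \sum_(j < n | (i < j)%N) W i j *: r i j (xi k).
pose P := \sum_k A (slot xi k (L k)).
have C0 : C = 0.
  suff : C = - C by move=> ?; lra.
  rewrite {1}/C (exchange_big_dep predT)//= -sumrN; apply: eq_bigr => k _.
  rewrite -sumrN; apply: eq_big => [l|l kl]; first by rewrite eq_sym.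
  apply/eqP; rewrite -addr_eq0; apply/eqP; rewrite -!big_split.
  pose B (u v : cotangent p) := A (slot (slot xi k u) l v).
  have BA (u v : cotangent p) : B u v = - B v u by rewrite /B (mv_swap mA).
  have Bl c (u u' v : cotangent p) : B (c *: u + u') v = c * B u v + B u' v.
    by rewrite BA {1}/B (mv_lin mA) (BA u) (BA u') /B; ring.
  have lk : l != k by rewrite eq_sym.
  rewrite -[RHS](transposed_terms_cancel Bl BA (xi k) (xi l)).
  apply: eq_bigr => i _; rewrite -big_split; apply: eq_bigr => j _.
  rewrite /Z /= [LHS]addrC; congr (_ + _).
  by rewrite -[A (slot (slot xi l _) k _)]opprK -(mv_swap mA _ _ _ lk)
    (slotC _ _ _ lk) mulrN.
(* [P] is the derivation extending sum_(i<j) omega(e_i, e_j) r(theta^i, theta^j), and [RA] is minus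
   such a derivation. *)
have -> : \sum_(i < n) \sum_(j < n | (i < j)%N) (W i j *: RA i j) xi = - P.
  rewrite /P -sumrN; under [RHS]eq_bigr do rewrite (mv_sum mA) -sumrN.
  rewrite [RHS]exchange_big; apply: eq_bigr => i _.
  under [RHS]eq_bigr do rewrite (mv_sum mA) -sumrN.
  rewrite [RHS](exchange_big_dep (fun j : 'I_n => (i < j)%N))//=.
  apply: eq_bigr => j ij; rewrite -[LHS]/(W i j * RA i j xi) RAE mulrN mulr_sumr.
  by rewrite -sumrN; apply: eq_big => k; rewrite ?ij ?(mvZ mA).
have -> : \sum_(i < n) \sum_(j < n)
      wedge_vector (E i) (contract_form (eta j) (RA i j)) xi =
    (-1) ^+ a * \sum_k \sum_i \sum_j xi k (E i) * RA i j (slot xi k (eta j)).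
  rewrite mulr_sumr; under [RHS]eq_bigr do rewrite mulr_sumr.
  rewrite [RHS]exchange_big; apply: eq_bigr => i _.
  under [RHS]eq_bigr do rewrite mulr_sumr.
  rewrite [RHS]exchange_big; apply: eq_bigr => j _.
  apply: eq_bigr => k _; rewrite mv_insert// exprD.
  have k2 : (-1) ^+ k * (-1) ^+ k = 1 :> R by rewrite -expr2 sqrr_sign.
  by rewrite -[RHS]mul1r -[X in X * (_ * (_ * _))]k2; ring.
(* On the diagonal, the minus sign of [RAE] meets the minus sign of [ricci_identity], so [P] appears
   here with the opposite sign to the left-hand side. *)
have -> : \sum_k \sum_i \sum_j xi k (E i) * RA i j (slot xi k (eta j)) = P - C.
  rewrite /P /C -sumrB; apply: eq_bigr => k _.
  have -> : L k = - \sum_i \sum_j xi k (E i) *: r i j (eta j).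
    by rewrite ricci_identity opprK.
  rewrite (mvN mA) (mv_sum mA) [X in _ - X](exchange_big_dep predT)//=.
  rewrite -opprD -big_split -sumrN.
  apply: eq_bigr => i _.
  rewrite (mv_sum mA) [X in - (_ + X)](exchange_big_dep predT)//= -big_split -sumrN.
  apply: eq_bigr => j _; rewrite RAE (bigD1 k)//= slotE slot_slot (mvZ mA).
  rewrite mulrN mulrDr mulr_sumr; congr (- (_ + _)).
  apply: eq_big => [l|l lk]; first by rewrite !andbT.
  by rewrite slotNE.
by rewrite C0 subr0 exprS; ring.
Qed.

End pointwise.

(** * Passage from the fields to the pointwise identity *)

Lemma is_multivectorB (R : realType) (n : nat) (M : manifold R n) (p : M) (a : nat)
    (A B : multivector p a) :
  is_multivector A -> is_multivector B -> is_multivector (A - B).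
Proof.
move=> mA mB; split=> [xi i k z z'|xi i j ij xiij].
  rewrite -![(A - B) _]/(A _ - B _) mA.1 mB.1; ring.
by rewrite -[LHS]/(A xi - B xi) (mA.2 _ _ _ ij xiij) (mB.2 _ _ _ ij xiij) subr0.
Qed.

Theorem theorem5p14 (R : realType) (m : nat) (P : manifold R (2 * m))
    (omega : symplectic_form P) (D : contravariant_derivative omega)
    (D_poisson : poisson_connection D) (D_torsion : torsion_vanishing D)
    (c : chart R (2 * m) P) (c_chart : smooth_chart c)
    (e : 'I_(2 * m) -> vfield P) (e_frame : frame_field (dom c) e)
    (theta : 'I_(2 * m) -> covfield P)
    (theta_dual : dual_coframe_field (dom c) e theta)
    (a : nat) (A : mvfield P a) (A_field : multivector_field setT A)
    (p : P) (p_U : dom c p) :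
  (-1) ^+ a *: \sum_(i < 2 * m) \sum_(j < 2 * m | (i < j)%N)
      omega p (e i p) (e j p) *: curvature D (theta i) (theta j) A p =
  \sum_(i < 2 * m) \sum_(j < 2 * m)
      wedge_vector (e i p)
        (contract_form (flat omega (e j p)) (curvature D (theta i) (theta j) A p)).
Proof.
have [[oU _ _ _ _] _] := c_chart.
have UU : dom c `<=` dom c by [].
have st := theta_dual.1.
have sA : multivector_field (dom c) A.
  by apply: multivector_field_sub A_field; exact: subsetT.
have sk i j : one_form (dom c) (koszul_bracket omega (theta i) (theta j)).
  exact: (koszul_bracket_smooth e_frame theta_dual D oU UU).
pose ext (x : cotangent p) := coframe_ext e theta x.
have sext x : one_form (dom c) (ext x).
  exact: (coframe_ext_smooth theta_dual x UU).
have extp x : ext x p = x by exact: (coframe_extE e_frame theta_dual x p_U).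
(* The constant coefficients at [p] are Kronecker deltas, so the extension is the coframe form
   itself as a field, and [first_bianchi] applies to three coframe forms. *)
have ext_theta k : ext (theta k p) = theta k.
  apply: functional_extensionality_dep => q; rewrite /ext /coframe_ext.
  rewrite (bigD1 k)//= theta_dual.2// eqxx scale1r big1 ?addr0// => i ik.
  by rewrite theta_dual.2// eq_sym (negPf ik) scale0r.
pose r i j x := form_curvature D (theta i) (theta j) (ext x) p.
apply: (@curvature_identity _ _ _ _ _ _ e_frame theta_dual omega p p_U r) => //.
- move=> i j k x y; rewrite /r -(form_curvature_lin e_frame theta_dual D oU UU)//.
  congr (form_curvature D _ _ _ p); apply: functional_extensionality_dep => q.
  exact: coframe_ext_lin.
- by move=> i j k; exact: (form_curvatureN e_frame theta_dual D oU UU).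
- move=> i j k; rewrite /r !ext_theta.
  exact: (first_bianchi e_frame theta_dual oU UU D_torsion).
- move=> i j u v.
  have := form_curvature_sym e_frame theta_dual oU UU D_poisson p_U (st i) (st j)
    (sext (flat omega u)) (sext (flat omega v)).
  by rewrite !extp !flatK.
- exact: sA.1.
- move=> i j.
  have mD eta (B : mvfield P a) : one_form (dom c) eta -> multivector_field (dom c) B ->
      multivector_field (dom c) (cder_mv D eta B).
    exact: (cder_mv_smooth e_frame theta_dual D oU UU).
  have mp eta (B : mvfield P a) : one_form (dom c) eta ->
      multivector_field (dom c) B -> is_multivector (cder_mv D eta B p).
    by move=> sx sB; exact: (mD eta B sx sB).1.
  apply: is_multivectorB; first apply: is_multivectorB; apply: mp => //; exact: mD.
- move=> i j xi; have := curvature_mvE e_frame theta_dual D oU UU p_U (st i) (st j) sA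
    (fun l => sext (xi l)).
  rewrite (_ : (fun l => ext (xi l)) ^~ p = xi)//.
  by apply/funext => l; exact: extp.
Qed.
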